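(* Let $\Gamma$ be a fine hyperbolic graph with $\mathrm{diam}_\Gamma(\Gamma)>2$ and $\mathrm{girth}(\Gamma)>20$, and let $\mathcal{G}=\{G_v\}_{v\in V(\Gamma)}$ be a collection of non-trivial finite groups. Then the graph product $\Gamma\mathcal{G}$ is properly proximal.
   Context: Graphs are simplicial (no loops, no multiple edges, undirected). A circuit is a closed path of length greater than 2 with no self-intersection except at its endpoints. $\mathrm{girth}(\Gamma)$ is the minimal length of a circuit ($\infty$ if there is none). A graph is fine if for every edge $e$ and $n\in\mathbb{N}$ only finitely many circuits of length at most $n$ contain $e$. A hyperbolic graph is a connected graph that is Gromov hyperbolic for the graph metric (edges of length 1). $\mathrm{diam}_\Gamma$ is the diameter in the graph metric. The graph product $\Gamma\mathcal{G}$ is the quotient of the free product $\ast_{v\in V(\Gamma)}G_v$ by the normal subgroup generated by all commutators $[g_v,g_w]$ with $(v,w)\in E(\Gamma)$, $g_v\in G_v$, $g_w\in G_w$. Proper proximality (Boutonnet–Ioana–Peterson): a group $G$ is properly proximal if there is no left-$G$-invariant state on the $C^*$-algebra $(\ell^\infty(G)/c_0(G))^{G_r}$ of those elements of $\ell^\infty(G)/c_0(G)$ that are invariant under the action of $G$ induced by right translation. *)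

(* Defs.v *)
From HB Require Import structures.
From mathcomp Require Import all_boot all_order all_algebra all_fingroup.
From mathcomp Require Import ring_quotient generic_quotient complex.
From mathcomp Require Import boolp classical_sets functions cardinality.
From mathcomp Require Import reals ereal.

Set Implicit Arguments.
Unset Strict Implicit.
Unset Printing Implicit Defensive.

Import Order.TTheory GRing.Theory Num.Theory.

Local Open Scope classical_set_scope.
Local Open Scope quotient_scope.
Local Open Scope ring_scope.

(* A simplicial graph is a symmetric irreflexive [e : rel V]; V may be infinite. *)

Section Graphs.
Variables (R : realType) (V : choiceType) (e : rel V).

(* The closed path x_0, ..., x_(n-1), x_0 is represented by its list of
   distinct vertices [:: x_0; ...; x_(n-1)]; its length n is the size. *)
Definition circuit (c : seq V) : Prop := ucycle e c /\ (2 < size c)%N.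

Definition circuit_contains (c : seq V) (x y : V) : Prop :=
  (x \in c /\ next c x = y) \/ (y \in c /\ next c y = x).

Definition fine_graph : Prop := forall (x y : V) (n : nat), e x y ->
  finite_set [set c | [/\ circuit c, (size c <= n)%N & circuit_contains c x y]].

Definition girth : \bar R :=
  ereal_inf [set ((size c)%:R)%:E | c in [set c | circuit c]].

Definition gpath (x y : V) (p : seq V) : Prop := path e x p /\ last x p = y.

Definition gconnected : Prop := forall x y, exists p, gpath x y p.

(* +oo when x and y lie in different components. *)
Definition gdist (x y : V) : \bar R :=
  ereal_inf [set ((size p)%:R)%:E | p in [set p | gpath x y p]].

Definition gdiam : \bar R :=
  ereal_sup [set gdist xy.1 xy.2 | xy in [set: V * V]].

Definition gromov_product (w x y : V) : R :=
  (fine (gdist x w) + fine (gdist y w) - fine (gdist x y)) / 2.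

Definition gromov_hyperbolic : Prop := exists delta : R, forall w x y z,
  Num.min (gromov_product w x y) (gromov_product w y z) - delta
    <= gromov_product w x z.

Definition hyperbolic_graph : Prop := gconnected /\ gromov_hyperbolic.

End Graphs.

Section FreeProduct.
Local Open Scope group_scope.
Variables (I : choiceType) (G : I -> groupType).

Definition fp_word := seq {i : I & G i}.

Definition fp_letter (i : I) (g : G i) : {i : I & G i} := Tagged G g.

(* The free product is the monoid of words modulo the congruence generated by
   multiplication inside each factor and deletion of trivial letters. *)
Inductive fp_eq : fp_word -> fp_word -> Prop :=
| fp_eq_refl u : fp_eq u u
| fp_eq_sym u v : fp_eq u v -> fp_eq v u
| fp_eq_trans u v w : fp_eq u v -> fp_eq v w -> fp_eq u w
| fp_eq_cat u u' v v' : fp_eq u u' -> fp_eq v v' -> fp_eq (u ++ v) (u' ++ v')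
| fp_eq_one i : fp_eq [:: fp_letter (1 : G i)] [::]
| fp_eq_mul i (g h : G i) :
    fp_eq [:: fp_letter g; fp_letter h] [:: fp_letter (g * h)].

Definition fp_eqb : rel fp_word := fun u v => `[< fp_eq u v >].

Lemma fp_eqb_equiv : equiv_class_of fp_eqb.
Proof.
split.
- by move=> u; apply/asboolP/fp_eq_refl.
- by move=> u v; apply/asboolP/asboolP => /fp_eq_sym.
- by move=> v u w /asboolP uv /asboolP vw; apply/asboolP/(fp_eq_trans uv).
Qed.

Canonical fp_equiv := EquivRelPack fp_eqb_equiv.

Definition free_product := {eq_quot fp_equiv}.
HB.instance Definition _ := Choice.on free_product.
HB.instance Definition _ := EqQuotient.on free_product.

Definition fp_inv_word (u : fp_word) : fp_word :=
  rev [seq fp_letter (tagged x : G (tag x))^-1 | x : {i : I & G i} <- u].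

Definition fp_one : free_product := \pi_free_product [::].
Definition fp_mul (x y : free_product) : free_product :=
  \pi_free_product (repr x ++ repr y).
Definition fp_inv (x : free_product) : free_product :=
  \pi_free_product (fp_inv_word (repr x)).

Lemma fp_piP (u v : fp_word) :
  (\pi_free_product u = \pi_free_product v) <-> fp_eq u v.
Proof. by split=> [/eqmodP/asboolP|h]; [|apply/eqmodP/asboolP]. Qed.

Lemma fp_repr_pi (u : fp_word) : fp_eq (repr (\pi_free_product u)) u.
Proof. by apply/fp_piP; rewrite reprK. Qed.

Lemma fp_mulE (u v : fp_word) :
  fp_mul (\pi u) (\pi v) = \pi_free_product (u ++ v).
Proof. by apply/fp_piP/fp_eq_cat; apply: fp_repr_pi. Qed.

Lemma fp_inv_word_cat (u v : fp_word) :
  fp_inv_word (u ++ v) = fp_inv_word v ++ fp_inv_word u.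
Proof. by rewrite /fp_inv_word map_cat rev_cat. Qed.

Lemma fp_inv_word_eq (u v : fp_word) :
  fp_eq u v -> fp_eq (fp_inv_word u) (fp_inv_word v).
Proof.
elim=> {u v} => [u|u v _ /fp_eq_sym //|u v w _ uv _ vw|u u' v v' _ uu _ vv|i|i g h].
- exact: fp_eq_refl.
- exact: fp_eq_trans uv vw.
- by rewrite !fp_inv_word_cat; apply: fp_eq_cat.
- by rewrite /fp_inv_word /= /rev /= invg1; apply: fp_eq_one.
- by rewrite /fp_inv_word /= /rev /= invgM; apply: fp_eq_mul.
Qed.

Lemma fp_mulVw (u : fp_word) : fp_eq (fp_inv_word u ++ u) [::].
Proof.
elim: u => [|[i g] u IHu]; first exact: fp_eq_refl.
rewrite -cat1s fp_inv_word_cat -catA [X in _ ++ X]catA.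
apply: fp_eq_trans IHu; apply: fp_eq_cat; first exact: fp_eq_refl.
rewrite -[X in fp_eq _ X]cat0s; apply: fp_eq_cat; last exact: fp_eq_refl.
apply: fp_eq_trans (fp_eq_one i).
rewrite /fp_inv_word /rev /= -(mulVg g); exact: fp_eq_mul.
Qed.

Lemma fp_mulA : associative fp_mul.
Proof.
elim/quotW=> u; elim/quotW=> v; elim/quotW=> w.
by rewrite !fp_mulE catA.
Qed.

Lemma fp_mul1 : left_id fp_one fp_mul.
Proof. by elim/quotW=> u; rewrite fp_mulE. Qed.

Lemma fp_mulr1 : right_id fp_one fp_mul.
Proof. by elim/quotW=> u; rewrite fp_mulE cats0. Qed.

Lemma fp_invE (u : fp_word) :
  fp_inv (\pi u) = \pi_free_product (fp_inv_word u).
Proof. by apply/fp_piP/fp_inv_word_eq/fp_repr_pi. Qed.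

Lemma fp_inv_wordK : involutive fp_inv_word.
Proof.
move=> u; rewrite /fp_inv_word map_rev revK -map_comp -[RHS]map_id.
by apply: eq_map => -[i g] /=; rewrite /fp_letter /= invgK.
Qed.

Lemma fp_mulV : left_inverse fp_one fp_inv fp_mul.
Proof. by elim/quotW=> u; rewrite fp_invE fp_mulE; apply/fp_piP/fp_mulVw. Qed.

Lemma fp_mulrV : right_inverse fp_one fp_inv fp_mul.
Proof.
elim/quotW=> u; rewrite fp_invE fp_mulE; apply/fp_piP.
by rewrite -{1}[u]fp_inv_wordK; apply: fp_mulVw.
Qed.

HB.instance Definition _ :=
  isGroup.Build free_product fp_mulA fp_mul1 fp_mulr1 fp_mulV fp_mulrV.

Definition fp_in (i : I) (g : G i) : free_product :=
  \pi_free_product [:: fp_letter g].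

End FreeProduct.

Section GroupQuotient.
Local Open Scope group_scope.
Variables (H : groupType) (S : set H).

Definition normal_subgroup (N : set H) : Prop :=
  [/\ N 1, forall x y, N x -> N y -> N (x * y), forall x, N x -> N x^-1
    & forall x y, N x -> N (x ^ y)].

Definition normal_closure : set H := smallest normal_subgroup S.

Lemma normal_closureP : normal_subgroup normal_closure.
Proof.
split.
- by move=> N [[]].
- by move=> x y Nx Ny N hN; case: (hN) => -[_ + _ _] _; apply; [exact: Nx|exact: Ny].
- by move=> x Nx N hN; case: (hN) => -[_ _ + _] _; apply; exact: Nx.
- by move=> x y Nx N hN; case: (hN) => -[_ _ _ +] _; apply; exact: Nx.
Qed.

Definition qg_eq : rel H := fun x y => `[< normal_closure (x^-1 * y) >].

Lemma qg_eq_equiv : equiv_class_of qg_eq.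
Proof.
have [N1 NM NV _] := normal_closureP.
have sym x y : qg_eq x y -> qg_eq y x.
  by move=> /asboolP/NV; rewrite invgM invgK => yx; apply/asboolP.
split; first by move=> x; apply/asboolP; rewrite mulVg.
  by move=> x y; apply/idP/idP => /sym.
move=> y x z /asboolP xy /asboolP yz; apply/asboolP.
by have := NM _ _ xy yz; rewrite -mulgA mulKVg.
Qed.

Canonical qg_equiv := EquivRelPack qg_eq_equiv.

(* H modulo the normal subgroup generated by S. *)
Definition quotient_group := {eq_quot qg_equiv}.
HB.instance Definition _ := Choice.on quotient_group.
HB.instance Definition _ := EqQuotient.on quotient_group.

Definition qg_one : quotient_group := \pi_quotient_group 1.
Definition qg_mul (x y : quotient_group) : quotient_group :=
  \pi_quotient_group (repr x * repr y).
Definition qg_inv (x : quotient_group) : quotient_group :=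
  \pi_quotient_group (repr x)^-1.

Lemma qg_piP (x y : H) :
  (\pi_quotient_group x = \pi_quotient_group y) <-> normal_closure (x^-1 * y).
Proof. by split=> [/eqmodP/asboolP|h]; [|apply/eqmodP/asboolP]. Qed.

Lemma qg_repr_pi (x : H) :
  normal_closure ((repr (\pi_quotient_group x))^-1 * x).
Proof. by apply/qg_piP; rewrite reprK. Qed.

Lemma qg_mulE (x y : H) :
  qg_mul (\pi x) (\pi y) = \pi_quotient_group (x * y).
Proof.
have [_ NM _ NJ] := normal_closureP; apply/qg_piP.
set a := repr _; set b := repr _.
suff -> : (a * b)^-1 * (x * y) = (b^-1 * y) * (a^-1 * x) ^ y.
  by apply: NM; first exact: qg_repr_pi; apply: NJ; exact: qg_repr_pi.
by rewrite conjgE invgM -!mulgA mulKVg.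
Qed.

Lemma qg_invE (x : H) : qg_inv (\pi x) = \pi_quotient_group x^-1.
Proof.
have [_ _ NV NJ] := normal_closureP; apply/qg_piP.
set a := repr _; rewrite invgK.
suff -> : a * x^-1 = ((a^-1 * x) ^ a^-1)^-1.
  by apply: NV; apply: NJ; exact: qg_repr_pi.
by rewrite conjgE invgK -mulgA mulKVg invgM invgK.
Qed.

Lemma qg_mulA : associative qg_mul.
Proof.
by elim/quotW=> x; elim/quotW=> y; elim/quotW=> z; rewrite !qg_mulE mulgA.
Qed.

Lemma qg_mul1 : left_id qg_one qg_mul.
Proof. by elim/quotW=> x; rewrite qg_mulE mul1g. Qed.

Lemma qg_mulr1 : right_id qg_one qg_mul.
Proof. by elim/quotW=> x; rewrite qg_mulE mulg1. Qed.

Lemma qg_mulV : left_inverse qg_one qg_inv qg_mul.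
Proof. by elim/quotW=> x; rewrite qg_invE qg_mulE mulVg. Qed.

Lemma qg_mulrV : right_inverse qg_one qg_inv qg_mul.
Proof. by elim/quotW=> x; rewrite qg_invE qg_mulE mulgV. Qed.

HB.instance Definition _ :=
  isGroup.Build quotient_group qg_mulA qg_mul1 qg_mulr1 qg_mulV qg_mulrV.

End GroupQuotient.

Section GraphProduct.
Local Open Scope group_scope.
Variables (V : choiceType) (e : rel V) (G : V -> groupType).

Definition gp_relators : set (free_product G) :=
  [set x | exists v w (g : G v) (h : G w), e v w /\ x = [~ fp_in g, fp_in h]].

Definition graph_product : groupType := quotient_group gp_relators.

End GraphProduct.

Section Linf.
Variables (R : realType) (G : groupType).
Local Notation C := (R[i]).

(* In the order of R[i], [z <= w] forces w - z to be real, so the bounds M and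
   eps below are automatically real. *)
Definition linf_pred : {pred (G -> C)} :=
  fun f => `[< exists M : C, forall x, `|f x| <= M >].

Lemma linf_predP (f : G -> C) :
  reflect (exists M : C, forall x, `|f x| <= M) (f \in linf_pred).
Proof. exact: asboolP. Qed.

Lemma linf_subring : subring_closed linf_pred.
Proof.
split=> [|f g /linf_predP[M fM] /linf_predP[N gN]|f g /linf_predP[M fM] /linf_predP[N gN]];
  apply/linf_predP.
- by exists 1 => x; rewrite normr1.
- exists (M + N) => x; apply: le_trans (ler_normB _ _) _.
  exact: lerD (fM x) (gN x).
- by exists (M * N) => x; rewrite normrM ler_pM.
Qed.

HB.instance Definition _ :=
  GRing.isSubringClosed.Build (G -> C) linf_pred linf_subring.

Lemma linf_scaler : GRing.scaler_closed linf_pred.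
Proof.
move=> a f /linf_predP[M fM]; apply/linf_predP; exists (`|a| * M) => x.
by rewrite [_ x]/(a * f x) normrM ler_wpM2l.
Qed.

HB.instance Definition _ :=
  GRing.isScaleClosed.Build C (G -> C) linf_pred linf_scaler.

Record linf := Linf { linf_fun :> G -> C; linf_funP : linf_fun \in linf_pred }.
HB.instance Definition _ := [isSub for linf_fun].
HB.instance Definition _ := [Choice of linf by <:].
HB.instance Definition _ :=
  GRing.SubChoice_isSubComPzRing.Build (G -> C) linf_pred linf linf_subring.
HB.instance Definition _ := [SubZmodule_isSubLmodule of linf by <:].

Lemma linf_precomp_subproof (h : G -> G) (f : linf) : f \o h \in linf_pred.
Proof. by have /linf_predP[M fM] := linf_funP f; apply/linf_predP; exists M => x /=. Qed.

Definition linf_precomp (h : G -> G) (f : linf) : linf :=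
  Linf (linf_precomp_subproof h f).

Lemma linf_star_subproof (f : linf) : (fun x => conjc (f x)) \in linf_pred.
Proof.
by have /linf_predP[M fM] := linf_funP f; apply/linf_predP; exists M => x; rewrite normcJ.
Qed.

Definition linf_star (f : linf) : linf := Linf (linf_star_subproof f).

Definition c0_pred : {pred linf} := fun f =>
  `[< forall eps : C, 0 < eps -> finite_set [set x | eps <= `|f x|] >].

Lemma c0_predP (f : linf) :
  reflect (forall eps : C, 0 < eps -> finite_set [set x | eps <= `|f x|])
          (f \in c0_pred).
Proof. exact: asboolP. Qed.

Lemma c0_zmod : zmod_closed c0_pred.
Proof.
split=> [|f g /c0_predP f0 /c0_predP g0]; apply/c0_predP => eps eps0.
  apply: (@sub_finite_set _ _ set0) => // x /=.
  by rewrite normr0 => /(lt_le_trans eps0); rewrite ltxx.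
have eps20 : 0 < eps / 2 by rewrite divr_gt0.
apply: (@sub_finite_set _ _ ([set x | eps / 2 <= `|f x|] `|` [set x | eps / 2 <= `|g x|])).
  move=> x /= efg; apply: contrapT => /not_orP[/negP + /negP].
  rewrite -!real_ltNge ?normr_real ?gtr0_real// => fx gx.
  have := le_lt_trans (ler_normB (f x) (g x)) (ltrD fx gx).
  by rewrite -splitr => /(le_lt_trans efg); rewrite ltxx.
by rewrite finite_setU; split; [exact: f0|exact: g0].
Qed.

HB.instance Definition _ := GRing.isZmodClosed.Build linf c0_pred c0_zmod.

Lemma c0_mull (a f : linf) : f \in c0_pred -> a * f \in c0_pred.
Proof.
move=> /c0_predP f0; apply/c0_predP => eps eps0.
have /linf_predP[M aM] := linf_funP a.
have M0 : 0 <= M by apply: le_trans (aM 1%g).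
have M1 : 0 < M + 1 by rewrite ltr_wpDl.
apply: sub_finite_set (f0 (eps / (M + 1)) (divr_gt0 eps0 M1)) => x /=.
rewrite ler_pdivrMr// => /le_trans; apply.
rewrite [_ x]/(a x * f x) normrM mulrC ler_wpM2l//.
by apply: le_trans (aM x) _; rewrite lerDl.
Qed.

(* l^oo(G) / c_0(G). It is the zero ring when G is finite, hence only a
   [comPzRingType]. *)
Definition corona := Quotient.quot c0_pred.
HB.instance Definition _ := GRing.Zmodule.on corona.
HB.instance Definition _ := EqQuotient.on corona.

Lemma corona_piP (f g : linf) : (\pi_corona f = \pi_corona g) <-> f - g \in c0_pred.
Proof.
rewrite -/(Quotient.equiv c0_pred f g).
by split=> [/eqmodP|h]; [|apply/eqmodP].
Qed.

Lemma corona_repr_pi (f : linf) : repr (\pi_corona f) - f \in c0_pred.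
Proof. by apply/corona_piP; rewrite reprK. Qed.


Lemma c0_mulB (f f' g g' : linf) :
  f - f' \in c0_pred -> g - g' \in c0_pred -> f * g - f' * g' \in c0_pred.
Proof.
move=> ff gg; have -> : f * g - f' * g' = g * (f - f') + f' * (g - g').
  by rewrite !mulrBr [g * f]mulrC [g * f']mulrC addrA addrNK.
by apply: rpredD; apply: c0_mull.
Qed.

Definition corona_one : corona := \pi_corona 1.
Definition corona_mul (x y : corona) : corona := \pi_corona (repr x * repr y).

Lemma corona_mulE (f g : linf) :
  corona_mul (\pi f) (\pi g) = \pi_corona (f * g).
Proof. by apply/corona_piP; apply: c0_mulB; apply: corona_repr_pi. Qed.

Lemma corona_mulA : associative corona_mul.
Proof.
move=> x y z; elim/quotW: x => f; elim/quotW: y => g; elim/quotW: z => h.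
by rewrite (corona_mulE g h) (corona_mulE f g) (corona_mulE f (g * h)) (corona_mulE (f * g) h) mulrA.
Qed.

Lemma corona_mulC : commutative corona_mul.
Proof. 
move=> x y; elim/quotW: x => f; elim/quotW: y => g.
by rewrite (corona_mulE f g) (corona_mulE g f) mulrC.
 Qed.

Lemma corona_mul1 : left_id corona_one corona_mul.
Proof. by elim/quotW=> f; rewrite corona_mulE mul1r. Qed.

Lemma corona_mulDl : left_distributive corona_mul +%R.
Proof.
move=> x y z; elim/quotW: x => f; elim/quotW: y => g; elim/quotW: z => h.
rewrite (corona_mulE f h) (corona_mulE g h) -!(raddfD \pi_corona).
by rewrite (corona_mulE (f + g) h) mulrDl.
Qed.

HB.instance Definition _ := GRing.Zmodule_isComPzRing.Build corona
  corona_mulA corona_mulC corona_mul1 corona_mulDl.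

Lemma c0_scale (a : C) (f : linf) : f \in c0_pred -> a *: f \in c0_pred.
Proof.
have -> : a *: f = (a *: (1 : linf) : linf) * f.
  by apply/val_inj/funext => x; exact: (congr1 ( *%R^~ (f x)) (esym (mulr1 a))).
exact: c0_mull.
Qed.

Definition corona_scale (a : C) (x : corona) : corona := \pi_corona (a *: repr x).

Lemma corona_scaleE a (f : linf) : corona_scale a (\pi f) = \pi_corona (a *: f).
Proof. by apply/corona_piP; rewrite -scalerBr; apply: c0_scale; apply: corona_repr_pi. Qed.

Lemma corona_scaleA a b x : corona_scale a (corona_scale b x) = corona_scale (a * b) x.
Proof. by elim/quotW: x => f; rewrite (corona_scaleE b f) (corona_scaleE a (b *: f)) scalerA -corona_scaleE. Qed.

Lemma corona_scale1 : left_id 1 corona_scale.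
Proof. by elim/quotW=> f; rewrite corona_scaleE scale1r. Qed.

Lemma corona_scaleDr : right_distributive corona_scale +%R.
Proof.
move=> a x y; elim/quotW: x => f; elim/quotW: y => g.
rewrite (corona_scaleE a f) (corona_scaleE a g) -!(raddfD \pi_corona).
by rewrite (corona_scaleE a (f + g)) scalerDr.
Qed.

Lemma corona_scaleDl x : {morph corona_scale^~ x : a b / a + b}.
Proof.
elim/quotW: x => f a b; rewrite (corona_scaleE (a + b) f).
by rewrite (corona_scaleE a f) (corona_scaleE b f) scalerDl -!(raddfD \pi_corona).
Qed.

HB.instance Definition _ := GRing.Zmodule_isLmodule.Build C corona
  corona_scaleA corona_scale1 corona_scaleDr corona_scaleDl.

Definition corona_star (x : corona) : corona := \pi_corona (linf_star (repr x)).

Lemma corona_starE (f : linf) : corona_star (\pi f) = \pi_corona (linf_star f).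
Proof.
apply/corona_piP/c0_predP => eps eps0.
apply: sub_finite_set ((c0_predP _ (corona_repr_pi f)) eps eps0) => x /=.
by rewrite -[X in _ -> _ <= X]normcJ rmorphB.
Qed.

Definition linf_ltrans (g : G) : linf -> linf := linf_precomp (fun x => g^-1 * x)%g.
Definition linf_rtrans (g : G) : linf -> linf := linf_precomp (fun x => x * g)%g.

Lemma c0_precomp (h : G -> G) (f : linf) :
  injective h -> f \in c0_pred -> linf_precomp h f \in c0_pred.
Proof.
move=> hI /c0_predP f0; apply/c0_predP => eps eps0.
apply: (@finite_preimage _ _ [set x | eps <= `|f x|] h); last exact: f0.
by move=> x y _ _; apply: hI.
Qed.

Definition corona_ltrans (g : G) (x : corona) : corona :=
  \pi_corona (linf_ltrans g (repr x)).
Definition corona_rtrans (g : G) (x : corona) : corona :=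
  \pi_corona (linf_rtrans g (repr x)).

Lemma corona_ltransE g (f : linf) :
  corona_ltrans g (\pi f) = \pi_corona (linf_ltrans g f).
Proof.
apply/corona_piP; apply: (@c0_precomp _ (repr (\pi_corona f) - f)).
  exact: mulgI.
exact: corona_repr_pi.
Qed.

Lemma corona_rtransE g (f : linf) :
  corona_rtrans g (\pi f) = \pi_corona (linf_rtrans g f).
Proof.
apply/corona_piP; apply: (@c0_precomp _ (repr (\pi_corona f) - f)).
  exact: mulIg.
exact: corona_repr_pi.
Qed.

Definition rinv_pred : {pred corona} := fun x => `[< forall g, corona_rtrans g x = x >].

Lemma rinv_predP (x : corona) :
  reflect (forall g, corona_rtrans g x = x) (x \in rinv_pred).
Proof. exact: asboolP. Qed.

Lemma corona_rtransB g : {morph corona_rtrans g : x y / x - y}.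
Proof.
move=> x y; elim/quotW: x => f; elim/quotW: y => h.
rewrite (corona_rtransE g f) (corona_rtransE g h) -!(raddfB \pi_corona).
by rewrite (corona_rtransE g (f - h)); congr (\pi_corona _); exact: val_inj.
Qed.

Lemma corona_rtransM g : {morph corona_rtrans g : x y / x * y}.
Proof.
move=> x y; elim/quotW: x => f; elim/quotW: y => h.
rewrite (corona_rtransE g f) (corona_rtransE g h) [LHS](_ : _ = corona_rtrans g (\pi_corona (f * h))).
  rewrite (corona_rtransE g (f * h)) [RHS](corona_mulE (linf_rtrans g f)).
  by congr (\pi_corona _); exact: val_inj.
by congr (corona_rtrans g _); exact: corona_mulE.
Qed.

Lemma corona_rtrans1 g : corona_rtrans g 1 = 1.
Proof. by rewrite [LHS](corona_rtransE g 1); congr (\pi_corona _); exact: val_inj. Qed.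

Lemma corona_rtransZ g a x : corona_rtrans g (a *: x) = a *: corona_rtrans g x.
Proof.
elim/quotW: x => f; rewrite (corona_rtransE g f).
transitivity (corona_rtrans g (\pi_corona (a *: f))).
  by congr (corona_rtrans g _); exact: corona_scaleE.
rewrite (corona_rtransE g (a *: f)) [RHS](corona_scaleE a (linf_rtrans g f)).
by congr (\pi_corona _); exact: val_inj.
Qed.

Lemma rinv_subring : subring_closed rinv_pred.
Proof.
split=> [|x y /rinv_predP xr /rinv_predP yr|x y /rinv_predP xr /rinv_predP yr];
  apply/rinv_predP => g.
- exact: corona_rtrans1.
- by rewrite corona_rtransB xr yr.
- by rewrite corona_rtransM xr yr.
Qed.

HB.instance Definition _ :=
  GRing.isSubringClosed.Build corona rinv_pred rinv_subring.

Lemma rinv_scaler : GRing.scaler_closed rinv_pred.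
Proof. by move=> a x /rinv_predP xr; apply/rinv_predP => g; rewrite corona_rtransZ xr. Qed.

HB.instance Definition _ := GRing.isScaleClosed.Build C corona rinv_pred rinv_scaler.

(* (l^oo(G) / c_0(G))^(G_r). *)
Record rinv := Rinv { rinv_val :> corona; rinv_valP : rinv_val \in rinv_pred }.
HB.instance Definition _ := [isSub for rinv_val].
HB.instance Definition _ := [Choice of rinv by <:].
HB.instance Definition _ :=
  GRing.SubChoice_isSubComPzRing.Build corona rinv_pred rinv rinv_subring.
HB.instance Definition _ := [SubZmodule_isSubLmodule of rinv by <:].

Lemma rinv_star_subproof (x : rinv) : corona_star x \in rinv_pred.
Proof.
apply/rinv_predP => g; have /rinv_predP/(_ g) := rinv_valP x.
elim/quotW: (rinv_val x) => f.
rewrite (corona_starE f) (corona_rtransE g f) => h.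
rewrite (corona_rtransE g (linf_star f)) -(corona_starE f) -[in RHS]h.
by rewrite (corona_starE (linf_rtrans g f)); congr (\pi_corona _); exact: val_inj.
Qed.

Definition rinv_star (x : rinv) : rinv := Rinv (rinv_star_subproof x).

Lemma rinv_ltrans_subproof (g : G) (x : rinv) : corona_ltrans g x \in rinv_pred.
Proof.
apply/rinv_predP => k; have /rinv_predP/(_ k) := rinv_valP x.
elim/quotW: (rinv_val x) => f.
rewrite (corona_ltransE g f) (corona_rtransE k f) => h.
rewrite (corona_rtransE k (linf_ltrans g f)) -(corona_ltransE g f) -[in RHS]h.
rewrite (corona_ltransE g (linf_rtrans k f)); congr (\pi_corona _).
by apply/val_inj/funext => z /=; rewrite mulgA.
Qed.

Definition rinv_ltrans (g : G) (x : rinv) : rinv := Rinv (rinv_ltrans_subproof g x).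

(* For positive functionals on a unital C*-algebra, norm 1 means phi 1 = 1. The
   positive elements are the a^* a; there is no state when G is finite (1 = 0). *)
Definition is_state (phi : {scalar rinv}) : Prop :=
  (forall a : rinv, 0 <= phi (rinv_star a * a)) /\ phi 1 = 1.

Definition properly_proximal : Prop :=
  ~ exists phi : {scalar rinv},
      is_state phi /\ forall g a, phi (rinv_ltrans g a) = phi a.

End Linf.

(* Main.v *)
(* Let M be an invariant state, viewed as a left-invariant mean on the functions
   f : G -> [0,1] such that f(xg) - f(x) -> 0 as x -> oo for every g. If
   f1 + f2 >= 1 - o(1) while each f_i has three left translates of sum at most 1,
   then 1 <= M f1 + M f2 <= 2/3, a contradiction. Such a pair exists in either of
   two cases, one of which always occurs for a fine connected graph.

   If the graph has countably many vertices, weight the vertices by a proper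
   function, so that the weighted syllable length |x| is proper. Choose vertices
   a, b at distance at least 3 and let U_a be the set of elements with an initial
   a-syllable. No vertex is adjacent to both a and b, so that
   |y^-1 z| = |y| + |z| for y in U_a and z in U_b, whence
   |x| <= d(x, U_a) + d(x, U_b), and f1 = min(d(x, U_a), |x|) / (1 + |x|) works
   together with its analogue f2 for b.

   Otherwise close a path from a to b under adding the circuits through an edge
   already present. By fineness this yields a countable, hence proper, set of
   vertices, and a vertex v of it with a neighbour outside it separates the
   graph. Then G splits over the finite group G_v and the f_i are the indicator
   functions of the two branches of this splitting. *)
Require Import Defs.
From HB Require Import structures.
From mathcomp Require Import all_boot all_order all_algebra all_fingroup.
From mathcomp Require Import ring_quotient generic_quotient complex.
From mathcomp Require Import boolp classical_sets functions cardinality.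
From mathcomp Require Import reals ereal.
From mathcomp Require Import lra ring zify.

Set Implicit Arguments.
Unset Strict Implicit.
Unset Printing Implicit Defensive.

Import Order.TTheory GRing.Theory Num.Theory.
Local Open Scope quotient_scope.

(** A left-invariant mean gives such a set mass at most 1/3, so two of them cannot cover the group.
    Two disjoint translates would only give 1/2 + 1/2 = 1, no contradiction. *)
Definition spread (H : groupType) (D : H -> Prop) : Prop :=
  exists g1 g2 g3 : H, forall x y, D x -> D y ->
    [/\ g1 * x <> g2 * y, g1 * x <> g3 * y & g2 * x <> g3 * y]%g.

Lemma spread_translate (H : groupType) (D E : H -> Prop) (h : H) :
  (forall x, D x -> E (h * x)%g) -> spread E -> spread D.
Proof.
move=> DE [g1 [g2 [g3 g_disj]]]; exists (g1 * h)%g, (g2 * h)%g, (g3 * h)%g => x y Dx Dy.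
by have := g_disj _ _ (DE _ Dx) (DE _ Dy); rewrite !mulgA.
Qed.

(** * Normal forms in graph products *)

Section Pilings.
Local Open Scope group_scope.
Variables (V : choiceType) (e : rel V) (G : V -> groupType).
Hypotheses (e_sym : symmetric e) (e_irr : irreflexive e).
Variable l : V -> nat.
Local Notation gp := (graph_product e G).

Definition gp_in (v : V) (g : G v) : gp :=
  \pi_(Defs.quotient_group (@gp_relators V e G)) (fp_in g).

Definition gp_word (w : fp_word G) : gp :=
  \pi_(Defs.quotient_group (@gp_relators V e G)) (\pi_(free_product G) w).

Lemma gp_wordM u w : gp_word (u ++ w) = gp_word u * gp_word w.
Proof.
rewrite /gp_word [RHS]qg_mulE; congr (\pi _).
by rewrite -fp_mulE.
Qed.

Lemma gp_word_surj x : exists w, x = gp_word w.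
Proof. by exists (repr (repr x)); rewrite /gp_word !reprK. Qed.

Lemma gp_word_nil : gp_word [::] = 1.
Proof. by []. Qed.

Lemma gp_word_cons (i : {v & G v}) w :
  gp_word (i :: w) = gp_in (tagged i) * gp_word w.
Proof. by rewrite -cat1s gp_wordM; case: i. Qed.

Lemma gp_inM v (g h : G v) : gp_in (g * h) = gp_in g * gp_in h.
Proof.
rewrite [RHS]qg_mulE /gp_in; congr (\pi _).
rewrite [RHS]fp_mulE; apply/fp_piP/fp_eq_sym; exact: fp_eq_mul.
Qed.

Lemma gp_in1 v : gp_in (1 : G v) = 1.
Proof. by apply: (mulgI (gp_in (1 : G v))); rewrite -gp_inM !mulg1. Qed.

Lemma gp_inV v (g : G v) : gp_in g^-1 = (gp_in g)^-1.
Proof. by apply: (mulgI (gp_in g)); rewrite -gp_inM !mulgV gp_in1. Qed.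

Lemma gp_in_comm v w (g : G v) (h : G w) : e v w ->
  gp_in g * gp_in h = gp_in h * gp_in g.
Proof.
move=> vw; rewrite [LHS]qg_mulE [RHS]qg_mulE; apply/esym/qg_piP => A [_]; apply.
by exists v, w, g, h; split=> //; rewrite /commg conjgE invMg !mulgA.
Qed.


(* A state consists of a stack over each vertex, the total weight of the stacked
   syllables and the group element that they spell. In the stack over [v] the
   letter 1 marks a syllable at another vertex not adjacent to [v], so that the
   top of the stack over [v] is the initial [v]-syllable (1 if there is none). *)
Definition state : Type := (forall v, seq (G v)) * nat * gp.

Definition state0 : state := (fun=> [::], 0%N, 1).

Definition top v (s : state) : G v := head 1 (s.1.1 v).

Definition push v (g : G v) (s : state) : state :=
  (fun u => if e u v then s.1.1 u else dfwith (fun u => 1 : G u) g u :: s.1.1 u,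
   (s.1.2 + l v)%N, gp_in g * s.2).

(** Inverse to [push]. A reduced state with nontrivial top over [v] is a push of that top, so there
    the truncated subtraction is exact. *)
Definition pop v (s : state) : state :=
  (fun u => if e u v then s.1.1 u else behead (s.1.1 u),
   (s.1.2 - l v)%N, (gp_in (top v s))^-1 * s.2).

Definition put v (g : G v) (s : state) : state := if g == 1 then s else push g s.

Definition rest v (s : state) : state := if top v s == 1 then s else pop v s.

Definition act v (g : G v) (s : state) : state := put (g * top v s) (rest v s).

Inductive reduced : state -> Prop :=
| reduced0 : reduced state0
| reduced_push v (g : G v) s :
    reduced s -> top v s = 1 -> g != 1 -> reduced (push g s).

Lemma top_push v (g : G v) s : top v (push g s) = g.
Proof. by rewrite /top /= e_irr /= dfwith_in. Qed.

Lemma top_push_adj u v (g : G v) s : e u v -> top u (push g s) = top u s.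
Proof. by rewrite /top /= => ->. Qed.

Lemma top_push_nadj u v (g : G v) s : u != v -> ~~ e u v -> top u (push g s) = 1.
Proof. by move=> uv /negPf nuv; rewrite /top /= nuv dfwith_out // eq_sym. Qed.

Lemma pop_push v (g : G v) s : pop v (push g s) = s.
Proof.
rewrite /pop top_push /=; case: s => -[s n] x /=; congr (_, _, _).
- by apply: functional_extensionality_dep => u /=; case: (e u v).
- by rewrite addnK.
- by rewrite mulKg.
Qed.

Lemma push_comm v w (g : G v) (h : G w) s : e v w ->
  push g (push h s) = push h (push g s).
Proof.
move=> vw; case: s => -[s n] x; rewrite /push /=; congr (_, _, _).
- apply: functional_extensionality_dep => u /=.
  (* If [u] is adjacent to neither [v] nor [w], it differs from both because [v] and [w] are
     adjacent; both pushes then put the marker 1 on its stack. *)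
  case: ifP => uv; case: ifP => uw //.
  have nuv : v != u by apply: contraFneq uw => <-.
  have nuw : w != u by apply: contraFneq uv => <-; rewrite e_sym.
  by rewrite !dfwith_out.
- by rewrite addnAC.
- by rewrite !mulgA gp_in_comm.
Qed.

Lemma top_put v (g : G v) s : top v s = 1 -> top v (put g s) = g.
Proof. by rewrite /put; case: eqP => [->|] // _ _; rewrite top_push. Qed.

Lemma rest_put v (g : G v) s : top v s = 1 -> rest v (put g s) = s.
Proof.
move=> s1; rewrite /rest top_put // /put; case: eqP => // _; exact: pop_push.
Qed.

Lemma act_put v (g h : G v) s : top v s = 1 -> act g (put h s) = put (g * h) s.
Proof. by move=> s1; rewrite /act top_put // rest_put. Qed.

Lemma top_put_adj u v (g : G v) s : e u v -> top u (put g s) = top u s.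
Proof. by rewrite /put; case: eqP => // _ /top_push_adj ->. Qed.

Lemma put_comm v w (g : G v) (h : G w) s : e v w ->
  put g (put h s) = put h (put g s).
Proof. by rewrite /put; do 2!case: eqP => // _; apply: push_comm. Qed.

Lemma reduced_put v (g : G v) s : reduced s -> top v s = 1 -> reduced (put g s).
Proof. by move=> rs s1; rewrite /put; case: eqP => // /eqP; apply: reduced_push. Qed.

(** The initial [v]-syllable can be made the last one pushed: a syllable pushed after it either sits
    at an adjacent vertex and commutes with it, or sits at [v] itself, or covers the stack over [v]
    with the marker 1, in which case [g] is 1. *)
Lemma reducedP v s : reduced s ->
  exists g : G v, exists t, [/\ reduced t, top v t = 1 & s = put g t].
Proof.
elim=> [|w h t rt IHt t1 h1].
  by exists 1, state0; split=> //; [exact: reduced0|rewrite /put eqxx].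
have [vw|nvw] := boolP (e v w); last first.
  have [wv|wv] := eqVneq w v; last first.
    exists 1, (push h t); split; [exact: reduced_push| |by rewrite /put eqxx].
    by rewrite top_push_nadj // eq_sym.
  move: wv h t1 h1 => -> h t1 h1 {nvw}.
  by exists h, t; split => //; rewrite /put (negPf h1).
have [g [r [rr r1 tE]]] := IHt.
have r1' : top w r = 1 by rewrite -t1 tE top_put_adj // e_sym.
exists g, (put h r); split; [exact: reduced_put|by rewrite top_put_adj|].
by rewrite put_comm // -tE /put (negPf h1).
Qed.

Lemma reduced_act v (g : G v) s : reduced s -> reduced (act g s).
Proof.
by move=> /(reducedP v)[h [t [rt t1 ->]]]; rewrite act_put //; apply: reduced_put.
Qed.

Lemma act1 v s : reduced s -> act (1 : G v) s = s.
Proof. by move=> /(reducedP v)[h [t [rt t1 ->]]]; rewrite act_put // mul1g. Qed.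

Lemma actM v (g h : G v) s : reduced s -> act (g * h) s = act g (act h s).
Proof. by move=> /(reducedP v)[k [t [rt t1 ->]]]; rewrite !act_put // mulgA. Qed.

Lemma actK v (g : G v) s : reduced s -> act g^-1 (act g s) = s.
Proof. by move=> rs; rewrite -actM // mulVg act1. Qed.

Lemma act_comm v w (g : G v) (h : G w) s : e v w -> reduced s ->
  act g (act h s) = act h (act g s).
Proof.
move=> vw /(reducedP v)[k [t [rt t1 ->]]]; have wv : e w v by rewrite e_sym.
have [m [r [rr r1 tE]]] := reducedP w rt.
have r1' : top v r = 1 by rewrite -t1 tE top_put_adj.
have tv (n : G w) : top v (put n r) = 1 by rewrite top_put_adj.
have tw (n : G v) : top w (put n r) = 1 by rewrite top_put_adj.
rewrite tE act_put // (put_comm (g * k)) // act_put //.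
by rewrite (put_comm k) // act_put // -(put_comm k) // act_put // put_comm.
Qed.

Definition act_word (w : fp_word G) (s : state) : state :=
  foldr (fun x => act (tagged x)) s w.

Lemma act_word_cat u w s : act_word (u ++ w) s = act_word u (act_word w s).
Proof. exact: foldr_cat. Qed.

Lemma reduced_act_word w s : reduced s -> reduced (act_word w s).
Proof. by move=> rs; elim: w => //= x w; apply: reduced_act. Qed.

Lemma act_word_fp u w : fp_eq u w ->
  forall s, reduced s -> act_word u s = act_word w s.
Proof.
elim=> {u w} [//|u w _ IH s rs|u v w _ IH1 _ IH2 s rs|u u' w w' _ IH1 _ IH2 s rs|v s rs|v g h s rs].
- by rewrite IH.
- by rewrite IH1 ?IH2.
- by rewrite !act_word_cat IH2 // IH1 //; apply: reduced_act_word.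
- exact: act1.
- by rewrite /= actM.
Qed.

(** The elements of the free product that act trivially on all reduced states form a normal subgroup
    containing the relators, hence contain the normal closure. So the graph product acts on reduced
    states. *)
Lemma act_word_gp u w : gp_word u = gp_word w ->
  forall s, reduced s -> act_word u s = act_word w s.
Proof.
move=> /qg_piP; set x := \pi u; set y := \pi w.
pose T := [set z : free_product G |
  forall s, reduced s -> act_word (repr z) s = s]%classic.
have TP (r : fp_word G) : T (\pi r) <-> forall s, reduced s -> act_word r s = s.
  have E s : reduced s -> act_word (repr (\pi_(free_product G) r)) s = act_word r s.
    exact/act_word_fp/fp_repr_pi.
  by split=> H s rs; [rewrite -E //; apply: H|rewrite E //; apply: H].
have TM a b : T a -> T b -> T (a * b).
  elim/quotW: a => a; elim/quotW: b => b /TP Ta /TP Tb.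
  rewrite [_ * _]fp_mulE; apply/TP => s rs.
  by rewrite act_word_cat Tb // Ta.
have invw a s : reduced s -> act_word (fp_inv_word a) (act_word a s) = s.
  by move=> rs; rewrite -act_word_cat (act_word_fp (fp_mulVw a)).
have invw' a s : reduced s -> act_word a (act_word (fp_inv_word a) s) = s.
  by move=> rs; rewrite -{1}[a]fp_inv_wordK invw.
have nT : normal_subgroup T.
  split=> //.
  - by apply/TP.
  - move=> a; elim/quotW: a => a /TP Ta; rewrite [_^-1]fp_invE; apply/TP => s rs.
    by rewrite -{1}(Ta s rs) invw.
  - move=> a b; elim/quotW: a => a; elim/quotW: b => b /TP Ta.
    rewrite /conjg [_^-1]fp_invE [X in _ * X]fp_mulE [_ * _]fp_mulE.
    apply/TP => s rs; rewrite !act_word_cat Ta ?invw //.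
    exact: reduced_act_word.
have RT : (@gp_relators V e G `<=` T)%classic.
  move=> _ [v [w' [g [h [vw ->]]]]].
  have fV (a : fp_word G) : (\pi_(free_product G) a : free_product G)^-1 =
    \pi_(free_product G) (fp_inv_word a).
    exact: fp_invE.
  have fM (a b : fp_word G) :
    (\pi_(free_product G) a : free_product G) * \pi_(free_product G) b =
    \pi_(free_product G) (a ++ b).
    exact: fp_mulE.
  rewrite /commg /conjg /fp_in !fV.
  rewrite (fM [:: fp_letter g]) (fM _ ([:: fp_letter g] ++ _)) fM.
  apply/TP => s rs; rewrite !act_word_cat /=.
  have c t : reduced t -> act g (act h t) = act h (act g t) by apply: act_comm.
  by rewrite c // actK ?actK //; apply: reduced_act.
move=> /(_ T (conj nT RT)).
rewrite /x /y [_^-1]fp_invE [_ * _]fp_mulE => /TP H s rs.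
by rewrite -{1}(H s rs) act_word_cat invw' //; apply: reduced_act_word.
Qed.

Definition pile (x : gp) : state := act_word (repr (repr x)) state0.

Lemma pile_word w : pile (gp_word w) = act_word w state0.
Proof. by apply: act_word_gp; [rewrite /gp_word !reprK|exact: reduced0]. Qed.

Lemma pile1 : pile 1 = state0.
Proof. by rewrite -gp_word_nil pile_word. Qed.

Lemma pile_in v (g : G v) x : pile (gp_in g * x) = act g (pile x).
Proof.
have [w ->] := gp_word_surj x.
by rewrite -[gp_in g]/(gp_in (tagged (fp_letter g))) -gp_word_cons !pile_word.
Qed.

Lemma reduced_pile x : reduced (pile x).
Proof. exact/reduced_act_word/reduced0. Qed.

Lemma act_push v (g : G v) s : top v s = 1 -> g != 1 -> act g s = push g s.
Proof. by move=> s1 /negPf g1; rewrite /act s1 mulg1 /rest s1 eqxx /put g1. Qed.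

(** With [pileE] this is the normal form theorem: reduced states correspond bijectively to group
    elements. *)
Lemma reduced_pileE s : reduced s -> s = pile s.2.
Proof.
elim=> [|v g t rt tE t1 g1]; first by rewrite pile1.
by rewrite pile_in -tE act_push.
Qed.

Lemma pileE x : (pile x).2 = x.
Proof.
have [w ->] := gp_word_surj x.
elim: w => [|[v g] w IH]; first by rewrite pile1.
rewrite gp_word_cons pile_in /=.
have [h [t [rt t1 E]]] := reducedP v (reduced_pile (gp_word w)).
rewrite -[in RHS]IH E act_put // /put; have [->|_] := eqVneq h 1.
  by rewrite mulg1; have [->|_] := eqVneq g 1; rewrite ?gp_in1 ?mul1g.
case: eqVneq => [gh|_] /=; last by rewrite gp_inM mulgA.
by rewrite mulgA -gp_inM gh gp_in1 mul1g.
Qed.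

(** * Initial syllables and weighted syllable length *)

Definition initial v (x : gp) : G v := top v (pile x).

Definition weight (x : gp) : nat := (pile x).1.2.

Lemma gp_ind (P : gp -> Prop) : P 1 ->
  (forall v (g : G v) x, g != 1 -> initial v x = 1 -> P x -> P (gp_in g * x)) ->
  forall x, P x.
Proof.
move=> P1 Ppush x; rewrite -[x]pileE; elim: (reduced_pile x) => // v g s rs IH s1 g1.
by apply: Ppush => //; rewrite /initial -reduced_pileE.
Qed.

Lemma gp_split v x : x = gp_in (initial v x) * (gp_in (initial v x)^-1 * x) /\
  initial v (gp_in (initial v x)^-1 * x) = 1.
Proof.
split; first by rewrite mulgA -gp_inM mulgV gp_in1 mul1g.
rewrite /initial pile_in.
have [h [t [rt t1 ->]]] := reducedP v (reduced_pile x).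
by rewrite top_put // act_put // mulVg top_put.
Qed.

Lemma initial1 v : initial v 1 = 1.
Proof. by rewrite /initial pile1. Qed.

Lemma weight1 : weight 1 = 0%N.
Proof. by rewrite /weight pile1. Qed.

Section Push.
Variables (v : V) (g : G v) (x : gp).
Hypotheses (g1 : g != 1) (x1 : initial v x = 1).

Lemma weight_push : weight (gp_in g * x) = (weight x + l v)%N.
Proof. by rewrite /weight pile_in act_push. Qed.

Lemma initial_push : initial v (gp_in g * x) = g.
Proof. by rewrite /initial pile_in act_push // top_push. Qed.

Lemma initial_push_adj u : e u v -> initial u (gp_in g * x) = initial u x.
Proof. by move=> uv; rewrite /initial pile_in act_push // top_push_adj. Qed.

Lemma initial_push_nadj u : u != v -> ~~ e u v -> initial u (gp_in g * x) = 1.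
Proof. by move=> uv nuv; rewrite /initial pile_in act_push // top_push_nadj. Qed.

Lemma initial_pushP u : initial u (gp_in g * x) != 1 ->
  u = v \/ e u v /\ initial u x != 1.
Proof.
have [->|uv] := eqVneq u v; first by left.
have [uv'|nuv] := boolP (e u v); first by rewrite initial_push_adj //; right.
by rewrite initial_push_nadj // eqxx.
Qed.

End Push.


Lemma initial_inM v (g : G v) x : initial v (gp_in g * x) = g * initial v x.
Proof.
rewrite /initial pile_in.
have [h [t [rt t1 ->]]] := reducedP v (reduced_pile x).
by rewrite act_put // !top_put.
Qed.

(** Once the [v]-syllable is split off and pushed back, only stacks over [v] and its neighbours can
    show a nontrivial top. *)
Lemma initial_clique u v x :
  initial u x != 1 -> initial v x != 1 -> u != v -> e u v.
Proof.
move=> ux vx uv; have [xE y1] := gp_split v x.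
by move: ux; rewrite xE => /(initial_pushP vx y1)[/eqP|[]//]; rewrite (negPf uv).
Qed.

Lemma initial0 x : (forall v, initial v x = 1) -> x = 1.
Proof.
elim/gp_ind: x => // v g x g1 x1 _ /(_ v).
by rewrite initial_push // => /eqP; rewrite (negPf g1).
Qed.

(** Nothing cancels if no vertex carries initial syllables of both. Moving the first syllable of
    [x], at [v], over to [y] preserves this: at neighbours of [v] nothing changes, at [v] the rest
    of [x] has no initial syllable, and elsewhere the new [y] has none. *)
Lemma weight_mulV x y : (forall u, initial u x = 1 \/ initial u y = 1) ->
  weight (x^-1 * y) = (weight x + weight y)%N.
Proof.
elim/gp_ind: x y => [|v g x g1 x1 IH] y xy; first by rewrite invg1 mul1g weight1.
have yv : initial v y = 1.
  by have [/eqP|//] := xy v; rewrite initial_push // (negPf g1).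
have gV1 : g^-1 != 1 by rewrite invg_eq1.
rewrite invMg -mulgA -gp_inV IH ?weight_push //; last first.
  move=> u.
  have [->|uv] := eqVneq u v; first by left.
  have [uv'|nuv] := boolP (e u v); last by right; rewrite initial_push_nadj.
  by have := xy u; rewrite !initial_push_adj.
by rewrite -addnA [(l v + _)%N]addnC.
Qed.

Lemma weightV x : weight x^-1 = weight x.
Proof.
by rewrite -[x^-1]mulg1 weight_mulV ?weight1 ?addn0 // => u; right; rewrite initial1.
Qed.

Lemma leq_weight_in v (g : G v) x : (weight (gp_in g * x) <= weight x + l v)%N.
Proof.
have [xE y1] := gp_split v x; set h := initial v x in xE y1; set y := _ * x in xE y1.
have le_yx : (weight y <= weight x)%N.
  rewrite xE; have [->|h1] := eqVneq h 1; first by rewrite gp_in1 mul1g.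
  by rewrite weight_push // leq_addr.
rewrite xE mulgA -gp_inM; have [->|gh1] := eqVneq (g * h) 1.
  by rewrite gp_in1 mul1g -xE (leq_trans le_yx) ?leq_addr.
by rewrite -xE weight_push // leq_add2r.
Qed.

Lemma leq_weightM x y : (weight (x * y) <= weight x + weight y)%N.
Proof.
elim/gp_ind: x => [|v g x g1 x1 IH]; first by rewrite mul1g weight1.
rewrite -mulgA (leq_trans (leq_weight_in _ _)) // weight_push //.
by rewrite addnAC leq_add2r.
Qed.

(** An element of weight at most n+1 is trivial or has a first syllable at one of finitely many
    vertices. Since weights are positive, the rest has weight at most n. *)
Lemma finite_weight_le :
  (forall v, 0 < l v)%N -> (forall n, finite_set [set v | (l v <= n)%N]%classic) ->
  (forall v, finite_set [set: G v]%classic) ->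
  forall n, finite_set [set x | (weight x <= n)%N]%classic.
Proof.
move=> l_gt0 l_fin G_fin; elim=> [|n IHn].
  apply: (@sub_finite_set _ _ [set 1]%classic) => // x /=.
  rewrite leqn0; elim/gp_ind: x => // v g x g1 x1 _.
  by rewrite weight_push // addn_eq0 [l v == _]gtn_eqF ?andbF.
apply: (@sub_finite_set _ _ ([set 1] `|` \bigcup_(v in [set v | (l v <= n.+1)%N])
    \bigcup_(g in [set: G v]) [set gp_in g * x | x in [set x | (weight x <= n)%N]])%classic).
  move=> x /=; elim/gp_ind: x => [|v g x g1 x1 _]; first by left.
  rewrite weight_push // => xn; right.
  exists v; first by rewrite /= (leq_trans _ xn) // leq_addl.
  exists g => //; exists x => //=.
  by rewrite -ltnS (leq_trans _ xn) // -addn1 leq_add2l.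
rewrite finite_setU; split=> //; apply: bigcup_finite => // v _.
by apply: bigcup_finite => // g _; apply: finite_image.
Qed.

(* Syllables of [y] that disappear or change when [y] is multiplied on the right
   by [h] only do so because [h] commutes past the whole of [y]. *)
Lemma initial_mulr u w (h : G w) y :
  initial u y = 1 -> initial u (y * gp_in h) != 1 ->
  [/\ w = u, y * gp_in h = gp_in h * y & forall t, initial t y != 1 -> e t u].
Proof.
elim/gp_ind: y u => [|t k y k1 y1 IH] u uy.
  rewrite mul1g mulg1 => uh; split=> // [|t]; last by rewrite initial1 eqxx.
  move: uh; rewrite -[gp_in h]mulg1; have [->|h1] := eqVneq h 1.
    by rewrite gp_in1 mulg1 initial1 eqxx.
  by move=> /(initial_pushP h1 (initial1 w)) [->|[_]] //; rewrite initial1 eqxx.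
have ut : u != t by apply: contra_neq k1 => ut; move: k y1 uy; rewrite ut => k y1; rewrite initial_inM y1 mulg1.
(* Either [k] stays a separate first syllable, and induction applies at [u]; or [h] moves to the
   front of [y] and merges with [k], and then any initial [u]-syllable was there before. *)
rewrite -mulgA; have [yt|yt] := eqVneq (initial t (y * gp_in h)) 1.
  move=> /(initial_pushP k1 yt)[/eqP|[eut uyh]]; first by rewrite (negPf ut).
  rewrite initial_push_adj // in uy.
  have [wu yh yu] := IH u uy uyh; split=> //.
    rewrite yh !mulgA gp_in_comm // e_sym wu //.
  by move=> s /(initial_pushP k1 y1)[->|[_ /yu]]; rewrite // e_sym.
have [wt yh yu] := IH t y1 yt.
rewrite yh; move: h yh {yt IH}; rewrite wt => h yh.
rewrite mulgA -gp_inM; have [->|kh] := eqVneq (k * h) 1.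
  rewrite gp_in1 mul1g => uy'.
  by move: uy; rewrite initial_push_adj ?yu // => /eqP; rewrite (negPf uy').
move=> /(initial_pushP kh y1)[/eqP|[eut uy']]; first by rewrite (negPf ut).
by move: uy; rewrite initial_push_adj // => /eqP; rewrite (negPf uy').
Qed.


(** An initial [a]-syllable excludes initial syllables at [b] and [d]. Left multiplication by [q] or
    [p] therefore destroys it, and the initial [d]-syllable tells the two translates apart. *)
Lemma spread_initial a b d : (exists q : G b, q != 1) -> (exists p : G d, p != 1) ->
    a != b -> ~~ e a b -> a != d -> ~~ e a d -> e d b ->
  spread (fun x => initial a x != 1).
Proof.
move=> [q q1] [p p1] ab nab ad nad db.
exists 1, (gp_in q), (gp_in p) => x y ax ay; rewrite mul1g.
have nb z : initial a z != 1 -> initial b z = 1.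
  by move=> az; apply: contraNeq nab => bz; apply: initial_clique az bz ab.
have nd z : initial a z != 1 -> initial d z = 1.
  by move=> az; apply: contraNeq nad => dz; apply: initial_clique az dz ad.
split=> xy.
- by move: ax; rewrite xy initial_push_nadj ?nb ?eqxx.
- by move: ax; rewrite xy initial_push_nadj ?nd ?eqxx.
- have := initial_push p1 (nd _ ay); rewrite -xy initial_push_adj ?nb ?nd // => /eqP.
  by rewrite eq_sym (negPf p1).
Qed.

(** A nontrivial [a]-syllable carries the complement of the previous set into that set. *)
Lemma spread_not_initial a b d :
    (exists r : G a, r != 1) -> (exists q : G b, q != 1) -> (exists p : G d, p != 1) ->
    a != b -> ~~ e a b -> a != d -> ~~ e a d -> e d b ->
  spread (fun x => initial a x = 1).
Proof.
move=> [r r1] hq hp ab nab ad nad db.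
apply: (@spread_translate _ _ _ (gp_in r) _ (spread_initial hq hp ab nab ad nad db)).
by move=> x ax; rewrite initial_push.
Qed.

(** * The splitting over a vertex group *)

Section Branches.
Variable v : V.

Definition core (x : gp) : gp := gp_in (initial v x)^-1 * x.

Lemma coreE x : x = gp_in (initial v x) * core x.
Proof. by case: (gp_split v x). Qed.

Lemma initial_core x : initial v (core x) = 1.
Proof. by case: (gp_split v x). Qed.

Lemma core_in (g : G v) x : core (gp_in g * x) = core x.
Proof. by rewrite /core initial_inM mulgA -gp_inM invMg mulgKV. Qed.

(** Passing to the core makes the set invariant under left multiplication by [G v]. When [v] cuts
    off [C], these are the elements whose normal form in the amalgam over [G v] starts in the factor
    of [C]. *)
Definition branch (C : V -> bool) (x : gp) : Prop :=
  exists2 u, C u & initial u (core x) != 1.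

Lemma branch_in C (g : G v) x : branch C (gp_in g * x) <-> branch C x.
Proof. by rewrite /branch core_in. Qed.

Lemma branch_initial (C : V -> bool) u x : ~~ C v -> C u -> initial u x != 1 -> branch C x.
Proof.
move=> Cv Cu ux; exists u => //; move: ux; rewrite {1}(coreE x).
have [->|k1] := eqVneq (initial v x) 1; first by rewrite gp_in1 mul1g.
move=> /(initial_pushP k1 (initial_core x))[uv|[]//].
by move: Cu; rewrite uv (negPf Cv).
Qed.

(** To leave the branch, [s] must cancel the initial syllable [h] of the core at some [u] in [C], so
    it commutes past the remainder [y']. An initial syllable of [y'] would be at a neighbour of [u]
    other than [v], hence in [C], and would keep the product in the branch. So [y'] is 1, and [x] is
    a product of two syllables from finite groups. *)
Lemma finite_branch_mulr (C : V -> bool) w (s : G w) :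
    (forall u, finite_set [set: G u]%classic) ->
    ~~ C v -> (forall u t, C u -> e u t -> t != v -> C t) ->
  finite_set [set x | branch C x /\ ~ branch C (x * gp_in s)]%classic.
Proof.
move=> G_fin Cv Csep.
apply: (@sub_finite_set _ _ (\bigcup_(g in [set: G v]) \bigcup_(h in [set: G w])
   [set gp_in g * gp_in h])%classic); last first.
  by apply: bigcup_finite => // g _; apply: bigcup_finite.
move=> x /= [[u Cu uy] nxs].
have {nxs} : ~ branch C (core x * gp_in s).
  by apply: contra_not nxs => bs; rewrite (coreE x) -mulgA; apply/branch_in.
have yv := initial_core x; have := coreE x; move: (core x) yv uy => y yv uy xE nys.
have [h [y' [h1 y'1 yE]]] : exists h : G u, exists y',
    [/\ h != 1, initial u y' = 1 & y = gp_in h * y'].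
  by exists (initial u y), (gp_in (initial u y)^-1 * y); have [] := gp_split u y.
have ysE : y * gp_in s = gp_in h * (y' * gp_in s) by rewrite yE mulgA.
have [y's1|y's1] := eqVneq (initial u (y' * gp_in s)) 1.
  by case: nys; apply: (branch_initial Cv Cu); rewrite ysE initial_push.
have [wu y'sE y'u] := initial_mulr y'1 y's1.
move: s nys ysE y's1 y'sE; rewrite wu => s nys ysE y's1 y'sE.
move: ysE; rewrite y'sE mulgA -gp_inM.
have [hs1|hs1] := eqVneq (h * s) 1; last first.
  by move=> ysE; case: nys; apply: (branch_initial Cv Cu); rewrite ysE initial_push.
rewrite hs1 gp_in1 mul1g => ysE; have [y'E|ny'] := eqVneq y' 1.
  by exists (initial v x) => //; exists h => //=; rewrite {1}xE yE y'E mulg1.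
have [t yt] : exists t, initial t y' != 1.
  apply: contrapT => nt; move: ny'; rewrite (_ : y' = 1) ?eqxx //.
  by apply: initial0 => t; apply/eqP; apply: contrapT => /negP ty; apply: nt; exists t.
case: nys; rewrite ysE; apply: (@branch_initial C t) => //.
apply: (Csep u) => //; first by rewrite e_sym y'u.
apply: contra_neq yt => tv; move: (y'u t); rewrite tv => vu.
apply/eqP; apply: contraPT yv => yv' /=; rewrite yE initial_push_adj ?vu //.
by apply/eqP.
Qed.

Variables C1 C2 : V -> bool.
Hypotheses (C1v : ~~ C1 v) (C2v : ~~ C2 v).
Hypothesis C_cover : forall u, u != v -> C1 u || C2 u.
Hypothesis C_disj : forall u, ~~ (C1 u && C2 u).
Hypothesis C_sep : forall u t, C1 u -> C2 t -> ~~ e u t.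

Lemma branch_disjoint x : branch C1 x -> branch C2 x -> False.
Proof.
move=> [u C1u ux] [t C2t tx]; have ut : u != t.
  by apply: contraNneq (C_disj u) => ut; rewrite {2}ut C1u C2t.
by have := C_sep C1u C2t; rewrite (initial_clique ux tx ut).
Qed.

Lemma branch_cover x : [\/ branch C1 x, branch C2 x | exists g : G v, x = gp_in g].
Proof.
have [|nb1] := pselect (branch C1 x); first by constructor 1.
have [|nb2] := pselect (branch C2 x); first by constructor 2.
constructor 3; exists (initial v x).
rewrite {1}(coreE x) (_ : core x = 1) ?mulg1 //; apply: initial0 => u.
have [->|uv] := eqVneq u v; first exact: initial_core.
apply/eqP; apply: contrapT => /negP ux; have /orP[Cu|Cu] := C_cover uv.
  by apply: nb1; exists u.
by apply: nb2; exists u.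
Qed.

Lemma branch12 u (h : G u) x : C2 u -> h != 1 -> branch C1 x -> branch C2 (gp_in h * x).
Proof.
move=> C2u h1 b1; apply: (branch_initial C2v C2u); rewrite initial_push //.
apply/eqP; apply: contrapT => /negP ux.
exact: (branch_disjoint b1 (branch_initial C2v C2u ux)).
Qed.

Lemma branch21 u (h : G u) x : C1 u -> h != 1 -> branch C2 x ->
  initial u x = 1 /\ branch C1 (gp_in h * x).
Proof.
move=> C1u h1 b2; have ux : initial u x = 1.
  apply/eqP; apply: contrapT => /negP ux.
  exact: (branch_disjoint (branch_initial C1v C1u ux) b2).
by split=> //; apply: (branch_initial C1v C1u); rewrite initial_push.
Qed.

(** Here [k] carries the second branch into the first, which [r] preserves. As [w] and [v] are not
    adjacent, [k], [r], [k] do not merge, so the third translate again starts with a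
    [w]-syllable. *)
Lemma spread_branch2 w : C1 w -> ~~ e w v ->
  (exists k : G w, k != 1) -> (exists r : G v, r != 1) -> spread (branch C2).
Proof.
move=> C1w nwv [k k1] [r r1].
have wv : w != v by apply: contraTneq C1w => ->.
have nvw : ~~ e v w by rewrite e_sym.
exists 1, (gp_in k), (gp_in k * gp_in r * gp_in k) => x y x2 y2.
rewrite -!mulgA mul1g; have [yw y1] := branch21 C1w k1 y2.
have [xw x1] := branch21 C1w k1 x2.
have yv : initial v (gp_in k * y) = 1 by rewrite initial_push_nadj // eq_sym.
split=> xy.
- by apply: (branch_disjoint y1); rewrite -xy.
- apply: (branch_disjoint _ x2); rewrite xy; apply: (branch_initial C1v C1w).
  by rewrite initial_push // initial_push_nadj.
- move/mulgI: xy => xy; apply: (branch_disjoint _ x2); rewrite xy.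
  exact/branch_in.
Qed.

Lemma spread_branch1 w u : C1 w -> ~~ e w v -> C2 u -> (exists h : G u, h != 1) ->
  (exists k : G w, k != 1) -> (exists r : G v, r != 1) -> spread (branch C1).
Proof.
move=> C1w nwv C2u [h h1] hk hr.
apply: spread_translate (spread_branch2 C1w nwv hk hr) => x; exact: (branch12 C2u h1).
Qed.

End Branches.

End Pilings.

(** * Almost right-invariant functions *)

Section Slow.
Local Open Scope ring_scope.
Local Open Scope classical_set_scope.
Variables (R : realType) (H : groupType).
Implicit Types (f : H -> R) (F : linf R H) (a : rinv R H).
Local Open Scope complex_scope.

Definition bounded_fun f : Prop := exists M, forall x, `|f x| <= M.

Definition slow f : Prop := forall g eps, 0 < eps ->
  finite_set [set x | eps <= `|f (x * g)%g - f x|].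

Lemma normc_real (r : R) : `|r%:C| = `|r|%:C.
Proof. by rewrite normc_def /= expr0n addr0 sqrtr_sqr. Qed.

Lemma c0_realP F f : (forall x, F x = (f x)%:C) ->
  (F \in @c0_pred R H) <-> (forall eps, 0 < eps -> finite_set [set x | eps <= `|f x|]).
Proof.
move=> Ff; split=> [/c0_predP F0 eps eps0|f0].
  have := F0 eps%:C; rewrite ltcR => /(_ eps0); apply: sub_finite_set => x /=.
  by rewrite Ff normc_real lecR.
apply/c0_predP => -[eps i]; rewrite ltcE /= => /andP[/eqP -> eps0].
by apply: sub_finite_set (f0 eps eps0) => x /=; rewrite Ff normc_real lecR.
Qed.

Lemma linf_of_real f : bounded_fun f -> exists F, forall x, F x = (f x)%:C.
Proof.
move=> [M fM]; have fb : (fun x => (f x)%:C) \in @linf_pred R H.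
  by apply/linf_predP; exists M%:C => x; rewrite normc_real lecR.
by exists (Linf fb).
Qed.

Lemma slow_rinv F f : (forall x, F x = (f x)%:C) ->
  slow f <-> \pi_(corona R H) F \in @rinv_pred R H.
Proof.
move=> Ff; have Frf g x : (linf_rtrans g F - F) x = (f (x * g)%g - f x)%:C.
  by rewrite [LHS](_ : _ = F (x * g)%g - F x) // !Ff rmorphB.
split=> [sf|/rinv_predP sF g].
  apply/rinv_predP => g; rewrite corona_rtransE; apply/corona_piP.
  by apply/(c0_realP (Frf g)); apply: sf.
by apply/(c0_realP (Frf g)); have := sF g; rewrite corona_rtransE => /corona_piP.
Qed.

(** The square root is Hölder of exponent 1/2, hence the threshold [eps ^+ 2]. This keeps square
    roots of positive parts inside the right-invariant algebra. *)
Lemma slow_sqrt f : slow f -> slow (fun x => Num.sqrt (Num.max (f x) 0)).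
Proof.
move=> sf g eps eps0; apply: sub_finite_set (sf g (eps ^+ 2) _); last exact: exprn_gt0.
move=> x /=; set s := f _; set t := f x.
set u := Num.sqrt (Num.max s 0); set v := Num.sqrt (Num.max t 0) => epsuv.
have u0 : 0 <= u by apply: sqrtr_ge0.
have v0 : 0 <= v by apply: sqrtr_ge0.
have u2 : u ^+ 2 = Num.max s 0 by rewrite sqr_sqrtr // le_max lexx orbT.
have v2 : v ^+ 2 = Num.max t 0 by rewrite sqr_sqrtr // le_max lexx orbT.
have : eps ^+ 2 <= `|u - v| ^+ 2 by rewrite lerXn2r ?nnegrE // ltW.
move=> /le_trans; apply.
have le1 : `|u - v| ^+ 2 <= `|u ^+ 2 - v ^+ 2|.
  rewrite subr_sqr normrM expr2 ler_wpM2l // (ger0_norm (addr_ge0 u0 v0)).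
  by rewrite ler_norml; apply/andP; split; lra.
apply: le_trans le1 _; rewrite u2 v2.
case: (lerP s 0) => s0; case: (lerP t 0) => t0; rewrite ?max_r ?max_l //.
all: try (by apply: ltW).
all: rewrite ?(max_r s0) ?(max_r t0) ?(max_l (ltW s0)) ?(max_l (ltW t0)).
all: rewrite ?subrr ?normr0 // ?sub0r ?subr0 ?normrN.
all: rewrite ger0_norm ?(ltW s0) ?(ltW t0) // ler_normr; apply/orP.
- by right; lra.
- by left; lra.
Qed.

Variable phi : {scalar (rinv R H)}.
Hypothesis phi_state : is_state phi.

(** Modulo functions vanishing at infinity, [f] equals its positive part, which is [Q^* Q] for the
    slow function [Q] given by its square root. *)
Lemma state_ge0 a F f : rinv_val a = \pi_(corona R H) F ->
  (forall x, F x = (f x)%:C) ->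
  (forall eps, 0 < eps -> finite_set [set x | f x <= - eps]) -> 0 <= phi a.
Proof.
move=> aF Ff f_ge0; have sf : slow f by apply/(slow_rinv Ff); rewrite -aF; apply: rinv_valP.
have [M FM] := linf_predP _ (linf_funP F).
have [Q Qq] : exists Q : linf R H, forall x, Q x = (Num.sqrt (Num.max (f x) 0))%:C.
  apply: linf_of_real; exists (Num.sqrt (complex.Re M)) => x.
  rewrite ger0_norm ?sqrtr_ge0 // ler_wsqrtr // ge_max.
  have := FM x; rewrite Ff normc_real lecE /= => /andP[_ fM].
  by rewrite (le_trans (ler_norm _) fM) (le_trans (normr_ge0 _) fM).
have sQ : \pi_(corona R H) Q \in @rinv_pred R H by apply/(slow_rinv Qq)/slow_sqrt.
suff -> : a = rinv_star (Rinv sQ) * Rinv sQ by apply: phi_state.1.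
apply: val_inj; rewrite [LHS]aF [RHS](_ : _ = \pi_(corona R H) (linf_star Q * Q)).
  apply/corona_piP/(c0_realP (f := fun x => f x - Num.max (f x) 0)) => [x|eps eps0].
    rewrite [LHS](_ : _ = F x - conjc (Q x) * Q x) // Ff Qq conjc_real.
    by rewrite -rmorphM -rmorphB /= -expr2 sqr_sqrtr // le_max lexx orbT.
  apply: sub_finite_set (f_ge0 eps eps0) => x /=.
  have [f0|f0] := lerP (f x) 0; last first.
    by rewrite subrr normr0 leNgt eps0.
  by rewrite subr0 ler0_norm // lerNr.
by rewrite [LHS](_ : _ = corona_star (\pi_(corona R H) Q) * \pi_(corona R H) Q) //
  corona_starE [LHS]corona_mulE.
Qed.

End Slow.

Theorem properly_proximal_of_spread (R : realType) (H : groupType) (f1 f2 : H -> R)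
    (g1 g2 g3 h1 h2 h3 : H) :
  bounded_fun f1 -> bounded_fun f2 -> slow f1 -> slow f2 ->
  (forall x, f1 (g1^-1 * x)%g + f1 (g2^-1 * x)%g + f1 (g3^-1 * x)%g <= 1)%R ->
  (forall x, f2 (h1^-1 * x)%g + f2 (h2^-1 * x)%g + f2 (h3^-1 * x)%g <= 1)%R ->
  (forall eps : R, 0 < eps -> finite_set [set x | f1 x + f2 x <= 1 - eps]%classic)%R ->
  properly_proximal R H.
Proof.
move=> b1 b2 s1 s2 f1_le f2_le f12 [phi [phi_state phi_inv]].
have [F1 Ff1] := linf_of_real b1; have [F2 Ff2] := linf_of_real b2.
pose a1 := Rinv ((slow_rinv Ff1).1 s1); pose a2 := Rinv ((slow_rinv Ff2).1 s2).
(* By invariance all three translates have the same value, so the right side is [phi] of a pointwise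
   nonnegative function. *)
have le1 (F : linf R H) f (sF : \pi_(corona R H) F \in @rinv_pred R H) k1 k2 k3 :
    (forall x, F x = (f x)%:C)%C ->
    (forall x, f (k1^-1 * x)%g + f (k2^-1 * x)%g + f (k3^-1 * x)%g <= 1)%R ->
    (0 <= 1 - 3%:R * phi (Rinv sF))%R.
  move=> Ff f_le; pose a := Rinv sF.
  have -> : (1 - 3%:R * phi a = phi (1 - (rinv_ltrans k1 a + rinv_ltrans k2 a + rinv_ltrans k3 a)))%R.
    by rewrite raddfB !raddfD /= !phi_inv phi_state.2; ring.
  apply: (state_ge0 phi_state
    (F := (1 - (linf_ltrans k1 F + linf_ltrans k2 F + linf_ltrans k3 F))%R)
    (f := fun x => (1 - (f (k1^-1 * x)%g + f (k2^-1 * x)%g + f (k3^-1 * x)%g))%R)).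
  - rewrite [LHS](_ : _ = (1 - (corona_ltrans k1 (\pi_(corona R H) F)
      + corona_ltrans k2 (\pi_(corona R H) F) + corona_ltrans k3 (\pi_(corona R H) F)))%R) //.
    by rewrite !corona_ltransE -!(raddfD \pi_(corona R H)) -(raddfB \pi_(corona R H)).
  - by move=> x; rewrite !(rmorphB, rmorphD) /= -!Ff.
  - move=> eps eps0; apply: (@sub_finite_set _ _ set0) => // x /=.
    by have := f_le x; lra.
have ge1 : (0 <= phi a1 + phi a2 - 1)%R.
  have -> : (phi a1 + phi a2 - 1 = phi (a1 + a2 - 1))%R.
    by rewrite raddfB raddfD /= phi_state.2.
  apply: (state_ge0 phi_state (F := (F1 + F2 - 1)%R) (f := fun x => (f1 x + f2 x - 1)%R)).
  - rewrite [LHS](_ : _ = (\pi_(corona R H) F1 + \pi_(corona R H) F2 - 1)%R) //.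
    by rewrite -!(raddfD \pi_(corona R H)) -(raddfB \pi_(corona R H)).
  - by move=> x; rewrite !(rmorphB, rmorphD) /= -Ff1 -Ff2.
  - move=> eps eps0; apply: sub_finite_set (f12 eps eps0) => x /=; lra.
have := le1 _ _ ((slow_rinv Ff1).1 s1) _ _ _ Ff1 f1_le.
have := le1 _ _ ((slow_rinv Ff2).1 s2) _ _ _ Ff2 f2_le.
rewrite -/a1 -/a2 => p2 p1.
(* The nonnegative quantities are combined with coefficients 1, 1 and 3; the values of [phi] cancel
   and -1 remains. *)
have := addr_ge0 (addr_ge0 p1 p2) (mulr_ge0 (ler0n _ 3) ge1).
have -> : (1 - 3%:R * phi a1 + (1 - 3%:R * phi a2) + 3%:R * (phi a1 + phi a2 - 1) = -1 :> R[i])%R by ring.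
by rewrite oppr_ge0 ler10.
Qed.

(** * Criteria for proper proximality of graph products *)

(** Disjointness of the translates lets at most one of the three points lie in [D], so at most one
    summand is nonzero. *)
Lemma spread_sum_le1 (R : realType) (H : groupType) (D : H -> Prop) (f : H -> R) :
  spread D -> (forall x, 0 <= f x <= 1)%R -> (forall x, ~ D x -> f x = 0%R) ->
  exists g1 g2 g3, forall x,
    (f (g1^-1 * x)%g + f (g2^-1 * x)%g + f (g3^-1 * x)%g <= 1)%R.
Proof.
move=> [g1 [g2 [g3 g_disj]]] f01 fD; exists g1, g2, g3 => x.
have f0 y : (f y <= 0)%R \/ D y /\ (f y <= 1)%R.
  have [Dy|nDy] := pselect (D y); last by left; rewrite fD.
  by right; have /andP[] := f01 y.
have [n1|[D1 l1]] := f0 (g1^-1 * x)%g; have [n2|[D2 l2]] := f0 (g2^-1 * x)%g;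
  have [n3|[D3 l3]] := f0 (g3^-1 * x)%g; try lra.
- by have [_ _] := g_disj _ _ D2 D3; rewrite !mulVKg.
- by have [_ +] := g_disj _ _ D1 D3; rewrite !mulVKg.
- by have [+ _] := g_disj _ _ D1 D2; rewrite !mulVKg.
- by have [+ _] := g_disj _ _ D1 D2; rewrite !mulVKg.
Qed.

Section Criteria.
Variables (R : realType) (V : choiceType) (e : rel V) (G : V -> groupType).
Hypotheses (e_sym : symmetric e) (e_irr : irreflexive e).
Hypothesis G_fin : forall v, finite_set [set: G v]%classic.
Hypothesis G_nontriv : forall v, exists g : G v, g != 1%g.
Local Notation gp := (graph_product e G).

(** Elements entering [D] under [s] are translates of those leaving it under the inverse of [s].
    Finiteness for a general [g] follows syllable by syllable. *)
Lemma slow_indicator (D : gp -> Prop) :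
  (forall w (s : G w), finite_set [set x | D x /\ ~ D (x * gp_in e s)%g]%classic) ->
  slow (fun x => (`[< D x >]%:R : R)%R).
Proof.
move=> D_fin.
have D_fin' w (s : G w) : finite_set [set x | D (x * gp_in e s)%g /\ ~ D x]%classic.
  apply: sub_finite_set (finite_preimage (f := fun x => x * gp_in e s)%g _ (D_fin w s^-1)%g).
    by move=> x /= [Dxs nDx]; rewrite gp_inV mulgK.
  by move=> x y _ _; apply: mulIg.
have fin_g g : finite_set [set x | `[< D (x * g)%g >] != `[< D x >]]%classic.
  elim/(@gp_ind V e G e_sym e_irr (fun=> 0%N)): g => [|v s y _ _ IH].
    by apply: (@sub_finite_set _ _ set0) => // x /=; rewrite mulg1 eqxx.
  apply: (@sub_finite_set _ _ ([set x | D x /\ ~ D (x * gp_in e s)%g] `|`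
    [set x | D (x * gp_in e s)%g /\ ~ D x] `|`
    (fun x => x * gp_in e s)%g @^-1` [set x | `[< D (x * y)%g >] != `[< D x >]])%classic).
    move=> x /=; rewrite mulgA => neq.
    have [eqs|] := eqVneq `[< D (x * gp_in e s)%g >] `[< D x >].
      by right; rewrite eqs.
    by case: asboolP; case: asboolP => //; left; [right|left].
  rewrite !finite_setU; do !split=> //.
  by apply: finite_preimage IH => x z _ _; apply: mulIg.
move=> g eps eps0; apply: sub_finite_set (fin_g g) => x /=.
by apply: contraTneq => ->; rewrite subrr normr0 -ltNge.
Qed.

Theorem properly_proximal_cut_vertex (v : V) (C1 C2 : V -> bool) (w u : V) :
  ~~ C1 v -> ~~ C2 v -> (forall t, t != v -> C1 t || C2 t) ->
  (forall t, ~~ (C1 t && C2 t)) -> (forall s t, C1 s -> C2 t -> ~~ e s t) ->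
  C1 w -> ~~ e w v -> C2 u -> properly_proximal R gp.
Proof.
move=> C1v C2v C_cover C_disj C_sep C1w nwv C2u.
pose b C := @branch V e G (fun=> 0%N) v C.
pose f C (x : gp) : R := (`[< b C x >]%:R)%R.
have f01 C x : (0 <= f C x <= 1)%R by rewrite /f ler0n lern1 leq_b1.
have f_out C x : ~ b C x -> f C x = 0%R by move=> nb; rewrite /f asboolF.
have f_bd C : bounded_fun (f C).
  by exists 1%R => x; have /andP[f0 f1] := f01 C x; rewrite ger0_norm.
have [g1 [g2 [g3 g_le]]] := spread_sum_le1 (spread_branch1 e_sym e_irr (fun=> 0%N) C1v C2v C_disj C_sep C1w
   nwv C2u (G_nontriv u) (G_nontriv w) (G_nontriv v)) (f01 C1) (f_out C1).
have [h1 [h2 [h3 h_le]]] := spread_sum_le1 (spread_branch2 e_sym e_irr (fun=> 0%N) C1v C_disj C_sep C1w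
   nwv (G_nontriv w) (G_nontriv v)) (f01 C2) (f_out C2).
apply: (properly_proximal_of_spread (f_bd C1) (f_bd C2) _ _ g_le h_le).
- apply: slow_indicator => t s; apply: finite_branch_mulr => // p q C1p pq qv.
  have /orP[//|C2q] := C_cover q qv.
  by have := C_sep p q C1p C2q; rewrite pq.
- apply: slow_indicator => t s; apply: finite_branch_mulr => // p q C2p pq qv.
  have /orP[C1q|//] := C_cover q qv.
  by have := C_sep q p C1q C2p; rewrite e_sym pq.
(* The branches cover everything outside the finite group [G v], and there the sum is at least 1. *)
- move=> eps eps0; apply: (@sub_finite_set _ _ [set gp_in e g | g in [set: G v]]%classic);
    last exact: finite_image.
  move=> x /=; have [bx|bx|[g ->] _] := branch_cover e_sym e_irr (fun=> 0%N) C_cover x; last by exists g.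
  + by have /andP[_ _] := f01 C2 x; have /andP[f0 _] := f01 C2 x; rewrite {1}/f asboolT //=; lra.
  + by have /andP[f0 _] := f01 C1 x; rewrite {2}/f asboolT //=; lra.
Qed.

(** * Countable vertex sets: distance functions for a proper weight *)

Section Weighted.
Variable l : V -> nat.
Hypotheses (l_gt0 : forall v, (0 < l v)%N)
           (l_fin : forall n, finite_set [set v | (l v <= n)%N]%classic).
Local Notation weight := (@weight V e G l).
Local Notation initial := (@initial V e G l).

Lemma weight_distP (D : gp -> Prop) : (exists x, D x) ->
  exists A : gp -> nat,
    (forall x, exists2 z, D z & A x = weight (x^-1 * z)%g) /\
    (forall x z, D z -> A x <= weight (x^-1 * z)%g)%N.
Proof.
move=> [z0 Dz0].
have /choice[A HA] : forall x, exists n, (exists2 z, D z & n = weight (x^-1 * z)%g) /\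
    (forall z, D z -> n <= weight (x^-1 * z)%g)%N.
  move=> x.
  have exn : exists n, `[< exists2 z, D z & n = weight (x^-1 * z)%g >].
    by exists (weight (x^-1 * z0)%g); apply/asboolP; exists z0.
  case: (ex_minnP exn) => n /asboolP Hn n_min; exists n; split=> // z Dz.
  by apply: n_min; apply/asboolP; exists z.
by exists A; split=> x; have [] := HA x.
Qed.

(** Right multiplication by [g] moves numerator and denominator by at most [c], and the ratio lies
    in [0,1]. So it changes by at most 2c / (1 + |xg|), which tends to 0 by properness. *)
Lemma ratio_slow (A : gp -> nat) : (forall x g, A (x * g)%g <= A x + weight g)%N ->
  slow (fun x => ((minn (A x) (weight x))%:R / (1 + (weight x)%:R) : R)%R).
Proof.
move=> A_lip g eps eps0; set c := weight g.
have [n n_gt] : exists n : nat, (2%:R * c%:R / eps <= n%:R :> R)%R.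
  exists (Num.truncn (2%:R * c%:R / eps)%R).+1; apply: ltW; exact: truncnS_gt.
apply: sub_finite_set (finite_preimage (f := fun x : gp => (x * g)%g) _
    (finite_weight_le e_sym e_irr l_gt0 l_fin G_fin n)); last first.
  by move=> x y _ _; apply: mulIg.
move=> x /= eps_le; rewrite -(ler_nat R); apply: le_trans n_gt.
have Nx : (weight (x * g) <= weight x + c)%N by apply: leq_weightM.
have Nxg : (weight x <= weight (x * g) + c)%N.
  by rewrite -{1}[x](mulgK g) /c -(weightV e_sym e_irr l g); apply: leq_weightM.
have Ax : (A (x * g)%g <= A x + c)%N by [].
have Axg : (A x <= A (x * g)%g + c)%N.
  by rewrite -{1}[x](mulgK g) /c -(weightV e_sym e_irr l g); apply: A_lip.
move: Nx Nxg Ax Axg eps_le; move: (weight x) (weight (x * g)%g) (A x) (A (x * g)%g).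
move=> p q a b pq qp ba ab.
set m := minn b q; set n' := minn a p.
have mn : (m <= n' + c)%N by rewrite /m /n'; lia.
have nm : (n' <= m + c)%N by rewrite /m /n'; lia.
have np : (n' <= p)%N by apply: geq_minr.
rewrite ler_pdivlMr // => eps_le.
have p1 : (0 < 1 + p%:R :> R)%R by rewrite ltr_pwDl.
have q1 : (0 < 1 + q%:R :> R)%R by rewrite ltr_pwDl.
pose z : R := (n'%:R / (1 + p%:R))%R.
have z0 : (0 <= z)%R by rewrite divr_ge0 // ltW.
have z1 : (z <= 1)%R.
  by rewrite ler_pdivrMr // mul1r (le_trans (_ : _ <= p%:R)%R) ?ler_nat // lerDr.
have zE : (n'%:R = z * (1 + p%:R))%R by rewrite divfK // gt_eqF.
(* The difference of the ratios is multiplied by the new denominator; both terms on the right are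
   then at most [c] in absolute value. *)
have : (eps * (1 + q%:R) <= `|(m%:R - n'%:R) + z * (p%:R - q%:R)|)%R.
  have -> : (m%:R - n'%:R + z * (p%:R - q%:R) = (m%:R / (1 + q%:R) - z) * (1 + q%:R) :> R)%R.
    by rewrite mulrBl divfK ?gt_eqF // zE; ring.
  by rewrite normrM (gtr0_norm q1) ler_wpM2r // ltW.
move=> /le_trans -/(_ (2 * c%:R)%R) H.
suff {H} /H : (`|(m%:R - n'%:R) + z * (p%:R - q%:R)| <= 2 * c%:R :> R)%R.
  have : (0 <= q%:R :> R)%R by []. nra.
have natD a' b' : (a' <= b' + c)%N -> (a'%:R <= b'%:R + c%:R :> R)%R.
  by rewrite -natrD ler_nat.
have := natD _ _ mn; have := natD _ _ nm; have := natD _ _ pq; have := natD _ _ qp.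
move: z z0 z1 {zE} => z z0 z1 h1 h2 h3 h4.
by rewrite ler_norml; apply/andP; split; nra.
Qed.

Theorem properly_proximal_countable (a b c d : V) :
  a != b -> ~~ e a b -> (forall t, e a t -> ~~ e b t) -> e c a -> e d b ->
  properly_proximal R gp.
Proof.
move=> ab nab no_nbr ca db.
have ba : b != a by rewrite eq_sym.
have nba : ~~ e b a by rewrite e_sym.
have nad : ~~ e a d by apply: contraL db => /no_nbr; rewrite e_sym.
have nbc : ~~ e b c by apply: no_nbr; rewrite e_sym.
have ad : a != d by apply: contraNneq nab => ->.
have bc : b != c by apply: contraNneq nba => ->.
pose U v := fun x : gp => initial v x != 1%g.
have U_ne v : exists x, U v x.
  have [g g1] := G_nontriv v; exists (gp_in e g * 1)%g.
  by rewrite /U initial_push ?g1 //; apply: initial1.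
have [A [A_ex A_min]] := weight_distP (U_ne a).
have [B [B_ex B_min]] := weight_distP (U_ne b).
have lip (D : gp -> Prop) (E : gp -> nat) : (forall x, exists2 z, D z & E x = weight (x^-1 * z)%g) ->
    (forall x z, D z -> E x <= weight (x^-1 * z)%g)%N ->
    forall x g, (E (x * g)%g <= E x + weight g)%N.
  move=> E_ex E_min x g; have [z Dz ->] := E_ex x.
  apply: leq_trans (E_min _ _ Dz) _; rewrite invMg -mulgA addnC -(weightV e_sym e_irr l g).
  exact: leq_weightM.
pose f (E : gp -> nat) x := ((minn (E x) (weight x))%:R / (1 + (weight x)%:R) : R)%R.
have w1 x : (0 < 1 + (weight x)%:R :> R)%R by rewrite ltr_pwDl.
have f01 E x : (0 <= f E x <= 1)%R.
  rewrite divr_ge0 ?(ltW (w1 x)) //= ler_pdivrMr // mul1r.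
  by rewrite (le_trans (_ : _ <= (weight x)%:R)%R) ?ler_nat ?geq_minr // lerDr.
(* The distance vanishes on [U v], so the ratio is supported on the complement, which is spread. *)
have f_out v (E : gp -> nat) : (forall x z, U v z -> E x <= weight (x^-1 * z)%g)%N ->
    forall x, ~ (initial v x = 1%g) -> f E x = 0%R.
  move=> E_min x /eqP vx; have := E_min x x vx.
  by rewrite mulVg weight1 // leqn0 /f => /eqP ->; rewrite min0n mul0r.
have f_bd E : bounded_fun (f E).
  by exists 1%R => x; have /andP[f0 f1] := f01 E x; rewrite ger0_norm.
have [g1 [g2 [g3 g_le]]] := spread_sum_le1 (spread_not_initial e_sym e_irr l (G_nontriv a)
  (G_nontriv b) (G_nontriv d) ab nab ad nad db) (f01 A) (f_out a A A_min).
have [h1 [h2 [h3 h_le]]] := spread_sum_le1 (spread_not_initial e_sym e_irr l (G_nontriv b)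
  (G_nontriv a) (G_nontriv c) ba nba bc nbc ca) (f01 B) (f_out b B B_min).
apply: (properly_proximal_of_spread (f_bd A) (f_bd B) _ _ g_le h_le).
- exact/ratio_slow/(lip (U a)).
- exact/ratio_slow/(lip (U b)).
(* With nearest points [y] and [z], |y| + |z| = |y^-1 z| <= A + B, while |x| <= |y| + A and |x| <=
   |z| + B. Adding the last two gives 2|x| <= 2(A + B). *)
have AB x : (weight x <= A x + B x)%N.
  have [y Uy ->] := A_ex x; have [z Uz ->] := B_ex x.
  have yz : weight (y^-1 * z)%g = (weight y + weight z)%N.
    apply: weight_mulV => // u; have [|uy] := eqVneq (initial u y) 1%g; first by left.
    right; apply/eqP; apply: contrapT => /negP uz.
    have [ua|ua] := eqVneq u a.
      by move: nab; rewrite -ua (initial_clique e_sym e_irr uz Uz) // ua.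
    have [ub|ub] := eqVneq u b.
      by move: nba; rewrite -ub (initial_clique e_sym e_irr uy Uy) // ub.
    have := no_nbr u; rewrite e_sym (initial_clique e_sym e_irr uy Uy ua) => /(_ isT).
    by rewrite e_sym (initial_clique e_sym e_irr uz Uz ub).
  have tri (s t r : gp) : (weight (s^-1 * r) <= weight (s^-1 * t) + weight (t^-1 * r))%N.
    by rewrite -{1}[r](mulVKg t) mulgA; apply: leq_weightM.
  have sym (s t : gp) : weight (s^-1 * t)%g = weight (t^-1 * s)%g.
    by rewrite -(weightV e_sym e_irr) invMg invgK.
  have := tri y x z; have := tri 1%g y x; have := tri 1%g z x.
  rewrite !invg1 !mul1g yz (sym y x) (sym z x); lia.
move=> eps eps0.
(* The sum of the two ratios is at least |x| / (1 + |x|), so a sum of at most 1 - eps forces |x| <=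
   1/eps. *)
have [n n_gt] : exists n : nat, (1 / eps <= n%:R :> R)%R.
  exists (Num.truncn (1 / eps)%R).+1; apply: ltW; exact: truncnS_gt.
apply: sub_finite_set (finite_weight_le e_sym e_irr l_gt0 l_fin G_fin n) => x /=.
rewrite /f -mulrDl ler_pdivrMr // -natrD => le_eps.
rewrite -(ler_nat R); apply: le_trans n_gt; rewrite ler_pdivlMr //.
have : ((weight x)%:R <= (minn (A x) (weight x) + minn (B x) (weight x))%:R :> R)%R.
  by rewrite ler_nat; have := AB x; lia.
nra.
Qed.

End Weighted.
End Criteria.

(** * Fine graphs *)

Section CircuitClosure.
Local Open Scope classical_set_scope.
Variables (V : choiceType) (e : rel V).
Hypotheses (e_sym : symmetric e) (e_fine : fine_graph e).

Definition conn (T : set V) (x y : V) : Prop :=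
  exists p, [/\ path e x p, last x p = y & forall t, t \in x :: p -> T t].

Lemma conn_trans T y x z : conn T x y -> conn T y z -> conn T x z.
Proof.
move=> [p [xp <- pT]] [q [yq <- qT]]; exists (p ++ q); rewrite cat_path last_cat.
split=> [|//|t]; first by rewrite xp.
rewrite -cat_cons mem_cat => /orP[/pT//|tq].
by apply: qT; rewrite inE tq orbT.
Qed.

Lemma conn_sym T x y : conn T x y -> conn T y x.
Proof.
move=> [p []]; elim: p x => [|z p IH] x /=.
  by move=> _ <- pT; exists [::].
move=> /andP[xz zp] py pT; apply: (@conn_trans _ z).
  by apply: IH => // t tp; apply: pT; rewrite inE tp orbT.
exists [:: x]; rewrite /= e_sym xz; split=> // t.
by rewrite !inE => /orP[/eqP->|/eqP->]; apply: pT; rewrite !inE eqxx ?orbT.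
Qed.

Lemma conn_sub T T' x y : T `<=` T' -> conn T x y -> conn T' x y.
Proof. by move=> TT [p [xp py pT]]; exists p; split=> // t /pT/TT. Qed.

Definition circuit_step (T : set V) : set V := T `|`
  [set z | exists x y c, [/\ circuit e [:: x, y & c], T x, T y & z \in c]].

Definition circuit_closure (T : set V) : set V :=
  \bigcup_n iter n circuit_step T.

Lemma circuit_closureP T x y c z : circuit e [:: x, y & c] ->
  circuit_closure T x -> circuit_closure T y -> z \in c -> circuit_closure T z.
Proof.
have mono m n : (m <= n)%N -> iter m circuit_step T `<=` iter n circuit_step T.
  move=> /subnK <-; elim: (n - m)%N => //= k IH t /IH kt; by left.
move=> cc [m _ mx] [n _ ny] zc; exists (maxn m n).+1 => //=; right.
by exists x, y, c; split=> //; [apply: mono mx; apply: leq_maxl|apply: mono ny; apply: leq_maxr].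
Qed.

(** By fineness each edge lies on finitely many circuits of each bounded length, so one step adds a
    countable union of finite vertex sets. *)
Lemma countable_circuit_closure T : countable T -> countable (circuit_closure T).
Proof.
move=> Tc; apply: bigcup_countable => // n _; elim: n => //= n.
move: (iter n _ T) => {Tc}T Tc.
pose X := \bigcup_(x in T) \bigcup_(y in T) \bigcup_(m in [set: nat])
  \bigcup_(c in [set c | [/\ circuit e c, (size c <= m)%N & circuit_contains c x y] /\ e x y])
    [set` c].
apply: (@sub_countable _ _ _ (\bigcup_(b in [set: bool]) if b then T else X)).
  apply: subset_card_le => z [Tz|[x [y [c [cc Tx Ty zc]]]]]; first by exists true.
  exists false => //; exists x => //; exists y => //; exists (size [:: x, y & c]) => //.
  exists [:: x, y & c]; last by rewrite /= !inE zc !orbT.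
  split; last by case: cc => /andP[/= /andP[]].
  by split=> //; left; rewrite /= !inE !eqxx.
apply: bigcup_countable => // -[] _ //.
apply: bigcup_countable => // x _; apply: bigcup_countable => // y _.
apply: bigcup_countable => // m _; apply: bigcup_countable => [|c _]; last first.
  exact/finite_set_countable/finite_seq.
apply: finite_set_countable; have [xy|nxy] := boolP (e x y); last first.
  by apply: (@sub_finite_set _ _ set0) => // c [].
by apply: sub_finite_set (e_fine m xy) => c [].
Qed.

(** A vertex added by a step is joined to the old vertex [y] by an arc of its circuit, all of whose
    vertices are added in the same step. *)
Lemma circuit_closure_conn T a : (forall z, T z -> conn T a z) ->
  forall z, circuit_closure T z -> conn (circuit_closure T) a z.
Proof.
move=> Ta z [n _ nz].
suff : conn (iter n circuit_step T) a z by apply: conn_sub => t nt; exists n.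
elim: n z nz => [|n IH] z /=; first exact: Ta.
move: (iter n _ T) IH => {Ta}T Ta.
have sub : T `<=` circuit_step T by move=> t; left.
move=> [/Ta|[x [y [c [cc Tx Ty zc]]]]]; first exact: conn_sub.
apply: conn_trans (conn_sub sub (Ta _ Ty)) _.
have cT t : t \in c -> circuit_step T t by move=> tc; right; exists x, y, c.
have yc : path e y c.
  by case: cc => /andP[/= /andP[_ +] _] _; rewrite rcons_path => /andP[].
move: yc cT; case/splitPr: zc => c1 c2.
rewrite -cat_rcons cat_path => /andP[yc1 _] cT; exists (rcons c1 z).
rewrite last_rcons; split=> // t; rewrite inE => /orP[/eqP->|tc1]; first exact: sub.
by apply: cT; rewrite mem_cat tc1.
Qed.

(* A path from [w] back to the closure avoiding its neighbour [v] would close up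
   inside the closure to a circuit through [w]. *)
Lemma circuit_closure_cut T a w v p : (forall z, T z -> conn T a z) ->
  ~ circuit_closure T w -> circuit_closure T v -> e w v ->
  path e w p -> v \notin w :: p -> ~ circuit_closure T (last w p).
Proof.
move=> Ta nSw Sv wv wp vp Sp; have Sa := circuit_closure_conn Ta.
have SP := @circuit_closureP T; move: (circuit_closure T) Sa SP nSw Sv Sp => S Sa SP nSw Sv Sp.
(* The path is cut just before its first entry [t] into the closure. *)
have [q [t [wq qS St qt vt]]] : exists q t, [/\ path e w q,
    forall s, s \in w :: q -> ~ S s, S t, e (last w q) t & v != t].
  elim: p w {wv} wp vp nSw Sp => [|y p IH] w //= /andP[wy yp] vp nSw Sp.
  have [Sy|nSy] := pselect (S y).
    exists [::], y; split=> //= [s|]; first by rewrite inE => /eqP ->.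
    by apply: contraNneq vp => ->; rewrite !inE eqxx orbT.
  have vp' : v \notin y :: p by apply: contraNN vp => vyp; rewrite inE vyp orbT.
  have [q [t [yq qS St qt vt]]] := IH y yp vp' nSy Sp.
  exists (y :: q), t; rewrite /= wy; split=> // s.
  by rewrite inE => /orP[/eqP->//|]; apply: qS.
move: qt; have [q' wq' uq' sub_q'] := shortenP wq => qt.
have [r [tr rv rS]] := conn_trans (conn_sym (Sa _ St)) (Sa _ Sv).
have := rv; have [r' tr' ur' sub_r'] := shortenP tr => r'v.
have {}rS s : s \in t :: r' -> S s.
  rewrite inE => /orP[/eqP->//|/sub_r' sr]; by apply: rS; rewrite inE sr orbT.
have {}qS s : s \in w :: q' -> ~ S s.
  rewrite inE => /orP[/eqP->//|/sub_q' sq]; by apply: qS; rewrite inE sq orbT.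
(* Since [v] differs from [t], the simple path from [t] to [v] has a first edge, which lies in the
   closure. Continuing from [v] to [w] and along [q'] back to [t] gives a circuit through that
   edge. *)
case: r' tr' ur' r'v rS {sub_r'} => [|t2 r'] tr' ur' r'v rS.
  by move: vt; rewrite -r'v eqxx.
apply: nSw; apply: (SP t t2 (r' ++ w :: q')).
- split; last by rewrite /= size_cat /= addnS.
  rewrite /ucycle -[t :: _]/((t :: t2 :: r') ++ (w :: q')); apply/andP; split.
    rewrite /= rcons_cat; move: tr' r'v => /= /andP[-> t2r'] r'v /=.
    by rewrite cat_path t2r' r'v /= e_sym wv /= rcons_path wq' /=.
  rewrite cat_uniq ur' uq' andbT.
  by apply/hasPn => s /qS nSs; apply/negP => /rS.
- by apply: rS; rewrite inE eqxx.
- by apply: rS; rewrite !inE eqxx orbT.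
- by rewrite mem_cat inE eqxx orbT.
Qed.

End CircuitClosure.

(** * The two cases for a fine connected graph *)

Lemma path_exit (V : choiceType) (e : rel V) (S : set V) x p :
  path e x p -> ~ S x -> S (last x p) -> exists w v, [/\ ~ S w, S v & e w v].
Proof.
elim: p x => [|y p IH] x //= /andP[xy yp] nSx Sp.
have [Sy|nSy] := pselect (S y); first by exists x, y.
exact: IH yp nSy Sp.
Qed.

Lemma countable_proper_weight (V : choiceType) : countable [set: V]%classic ->
  exists l : V -> nat, (forall v, 0 < l v)%N /\
    forall n, finite_set [set v | (l v <= n)%N]%classic.
Proof.
move=> /countable_injP[f f_inj]; exists (fun v => (f v).+1); split=> // n.
apply: (@finite_preimage _ _ [set m | (m < n)%N]%classic f); last exact: finite_II.
by move=> x y _ _; apply: f_inj; rewrite inE.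
Qed.

Lemma gdiam_gt2 (R : realType) (V : choiceType) (e : rel V) :
  symmetric e -> ((2 : R)%:E < gdiam R e)%E ->
  exists a b, [/\ a != b, ~~ e a b & forall t, e a t -> ~~ e b t].
Proof.
move=> e_sym /ereal_sup_gt[_ [[a b] _ <-] /= ab2].
have far p : gpath e a b p -> (2 < size p)%N.
  move=> abp; have : (gdist R e a b <= ((size p)%:R)%:E)%E.
    by apply: ereal_inf_lbound; exists p.
  by move=> /(lt_le_trans ab2); rewrite lte_fin ltr_nat.
exists a, b; split.
- by apply/eqP => ab; have := far [::] (conj isT ab).
- by apply/negP => ab; have := far [:: b]; rewrite /gpath /= ab => /(_ (conj isT erefl)).
- move=> t at_; apply/negP => bt; have := far [:: t; b].
  by rewrite /gpath /= at_ e_sym bt => /(_ (conj isT erefl)).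
Qed.

Lemma gconnected_nbr (V : choiceType) (e : rel V) a b :
  gconnected e -> a != b -> exists c, e a c.
Proof.
move=> e_conn ab; have [[|c p] [/= ap pb]] := e_conn a b.
  by move: ab; rewrite pb eqxx.
by exists c; case/andP: ap.
Qed.

Theorem fine_graph_properly_proximal (R : realType) (V : choiceType) (e : rel V)
    (G : V -> groupType) :
  symmetric e -> irreflexive e -> fine_graph e -> gconnected e ->
  ((2 : R)%:E < gdiam R e)%E -> (forall v, finite_set [set: G v]%classic) ->
  (forall v, exists g : G v, g != 1%g) -> properly_proximal R (graph_product e G).
Proof.
move=> e_sym e_irr e_fine e_conn e_diam G_fin G_nontriv.
have [a [b [ab nab no_nbr]]] := gdiam_gt2 e_sym e_diam.
have [c ac] := gconnected_nbr e_conn ab.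
have [d bd] : exists d, e b d by apply: (gconnected_nbr (b := a)); rewrite // eq_sym.
have [p [ap pb]] := e_conn a b.
pose T := [set` a :: p]%classic; pose S := circuit_closure e T.
have Ta z : T z -> conn e T a z.
  rewrite /T => /= zp; move: zp ap => /splitPl[p1 p2 p1z]; rewrite cat_path => /andP[ap1 _].
  by exists p1; split=> // t; rewrite /= -cat_cons mem_cat => ->.
have TS : (T `<=` S)%classic by move=> z Tz; exists 0%N.
have Sa : S a by apply: TS; rewrite /T /= inE eqxx.
have Sb : S b by apply: TS; rewrite /T /= -pb mem_last.
have [SV|] := pselect (forall v, S v).
  have cV : countable [set: V]%classic.
    rewrite (_ : setT = S); last by apply/seteqP; split=> // v _; apply: SV.
    exact/countable_circuit_closure/finite_set_countable/finite_seq.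
  have [l [l_gt0 l_fin]] := countable_proper_weight cV.
  apply: (properly_proximal_countable e_sym e_irr G_fin G_nontriv l_gt0 l_fin ab nab no_nbr).
    by rewrite e_sym; exact: ac.
  by rewrite e_sym; exact: bd.
move=> /existsNP[x nSx]; have [q [xq qa]] := e_conn x a.
have [w [v [nSw Sv wv]]] : exists w v, [/\ ~ S w, S v & e w v].
  by apply: (path_exit xq nSx); rewrite qa.
(* [C2] is the component of [w] in the graph without [v], and [C1] consists of all other vertices
   except [v]. *)
pose C2 t := `[< exists r, [/\ path e w r, v \notin w :: r & last w r = t] >].
pose C1 t := (t != v) && ~~ C2 t.
have C2v : ~~ C2 v.
  by apply/asboolPn => -[r [_ + rv]]; rewrite -{1}rv mem_last.
have C2w : C2 w.
  apply/asboolP; exists [::]; split=> //; rewrite inE.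
  by apply: contraPneq Sv => ->.
have C2_step s t : C2 s -> e s t -> t != v -> C2 t.
  move=> /asboolP[r [wr vr <-]] st tv; apply/asboolP; exists (rcons r t).
  by rewrite rcons_path wr st last_rcons -rcons_cons mem_rcons inE negb_or eq_sym tv vr.
have SC1 z : S z -> z != v -> C1 z.
  move=> Sz zv; rewrite /C1 zv; apply/asboolPn => -[r [wr vr rz]].
  by apply: (circuit_closure_cut e_sym Ta nSw Sv wv wr vr); rewrite rz.
(* As [a] and [b] are at distance at least 3, [v] cannot be equal or adjacent to both, so one of
   them serves as [z]. *)
have [z Sz /andP[zv nzv]] : exists2 z, S z & (z != v) && ~~ e z v.
  have [va|va] := eqVneq a v; first by exists b; rewrite // -va eq_sym ab e_sym nab.
  have [vb|vb] := eqVneq b v; first by exists a; rewrite // -vb ab nab.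
  have [av|nav] := boolP (e a v); last by exists a; rewrite // va nav.
  by exists b; rewrite // vb no_nbr.
apply: (properly_proximal_cut_vertex e_sym e_irr G_fin G_nontriv
  (v := v) (C1 := C1) (C2 := C2) (w := z) (u := w)) => //.
- by rewrite /C1 eqxx.
- by move=> t tv; rewrite /C1 tv orNb.
- by move=> t; rewrite /C1 -andbA andNb andbF.
- move=> s t /andP[sv nC2s] C2t; apply/negP => st.
  by move/negP: nC2s; apply; apply: C2_step C2t _ sv; rewrite e_sym.
- exact: SC1.
Qed.

Local Open Scope ring_scope.

Theorem corollary1p2 (R : realType) (V : choiceType) (e : rel V)
    (G : V -> finGroupType)
    (e_sym : symmetric e) (e_irr : irreflexive e)
    (e_fine : fine_graph e) (e_hyp : hyperbolic_graph R e)
    (e_diam : ((2 : R)%:E < gdiam R e)%E)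
    (e_girth : ((20 : R)%:E < girth R e)%E)
    (G_nontriv : forall v, (1 < #|{: G v}|)%N) :
  properly_proximal R (graph_product e (fun v => G v)).
Proof.
apply: fine_graph_properly_proximal => // [|v|v]; first exact: e_hyp.1.
  exact: finite_finset.
have /card_gt1P[x [y [_ _ xy]]] := G_nontriv v.
have [x1|x1] := eqVneq x 1%g; last by exists x.
by exists y; rewrite eq_sym -x1.
Qed.
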